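(* Let $k\in\mathbb{N}$ and let $f_2,f_3\in\mathbb{R}[X_1,\ldots,X_n]$ be forms of degree $2k$ and $3k$, respectively. Denote $U:=\operatorname{sosupp} f_2$ and $N:=\dim U$. Assume that the space spanned by the threefold products $\{u\cdot v\cdot w\mid u,v,w\in U\}$ has dimension $\binom{N+2}{3}$. Then $f_2$ and $f_3$ have (up to reordering of the pairs $(q_i,\lambda_i)$) at most one joint powers-of-forms decomposition $$f_d=\sum_{i=1}^m\lambda_i q_i^d,\qquad d=2,3,$$ with $m\in\mathbb{N}$, positive weights $\lambda_1,\ldots,\lambda_m>0$ and linearly independent $q_1,\ldots,q_m\in\mathbb{R}[X]_k$. Furthermore, if such a decomposition exists, then Algorithm P (described in the context) computes it efficiently from the input $k,f_2,f_3$, and it is the unique minimum rank powers-of-forms decomposition of $(f_2,f_3)$.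
   Context: $\mathbb{N}=\{1,2,\ldots\}$, $X=(X_1,\ldots,X_n)$, and $\mathbb{R}[X]_k$ is the space of forms (homogeneous polynomials) of degree $k$. Sum-of-Squares support: for a form $f\in\mathbb{R}[X]_{2k}$, $$\operatorname{sosupp} f=\{p\in\mathbb{R}[X]_k\mid\exists\lambda\in\mathbb{R}_{>0}:\ f-\lambda p^2\text{ is a sum of squares}\}.$$ If $f$ is a sum of squares of forms, this is a linear subspace of $\mathbb{R}[X]_k$. A (joint) powers-of-forms (POF) decomposition of rank $m$ of $(f_2,f_3)$ is a choice of $q_1,\ldots,q_m\in\mathbb{R}[X]_k$ and $\lambda_1,\ldots,\lambda_m\in\mathbb{R}_{\ge 0}$ with $f_d=\sum_{i=1}^m\lambda_iq_i^d$ for $d=2,3$. It is of minimum rank if no POF decomposition of $(f_2,f_3)$ with fewer addends exists. Decompositions are considered up to reordering of the pairs $(q_i,\lambda_i)$. Gram spectrahedron: $\operatorname{Gram}(f)=\{G\succeq 0\mid [X]_k^TG[X]_k=f\}$, where $[X]_k$ is the vector of monomials of degree $k$. A vector $c$ is identified with the form $[X]_k^Tc$. Algorithm P. Input: $k$, $f_2$, $f_3$. (1) Compute, with an interior point semidefinite programming solver, a relative interior point $G$ of $\operatorname{Gram}(f_2)$ and a basis $u=(u_1,\ldots,u_N)$ of its image, which is a basis of $U=\operatorname{sosupp} f_2$. (2) For $d=2,3$ solve the linear system $f_d=\sum_{|\alpha|=d}c_\alpha u^\alpha$ (with $\alpha\in\mathbb{N}_0^N$) for its unique solution $(c_\alpha)_{|\alpha|=d}$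 and set $g_d=\sum_{|\alpha|=d}c_\alpha Y^\alpha\in\mathbb{R}[Y_1,\ldots,Y_N]_d$. (3) Compute the set $\{(\ell_1,\lambda_1),\ldots,(\ell_m,\lambda_m)\}$ of linearly independent linear forms $\ell_i$ and nonzero weights $\lambda_i$ with $g_d=\sum_i\lambda_i\ell_i^d$, $d=2,3$, as follows: compute a basis $w=(w_1,\ldots,w_m)$ of the space $\{\partial_vg_2\mid v\in\mathbb{R}^N\}$; choose a random $v\in\mathbb{R}^N$ from a continuous distribution; write $g_2=w^TMw$ and $\frac13\partial_vg_3=w^TM_vw$ with symmetric $M,M_v\in\mathbb{R}^{m\times m}$; compute the generalized eigenpairs $M_vx_j=\mu_jMx_j$; set $b_j=Mx_j$, $a_j=\frac{\mu_j}{b_j^Tw(v)}b_j$, $\ell_j=a_j^Tw$; obtain the $\lambda_j$ from the linear system $g_2=\sum_j\lambda_j\ell_j^2$. (4) Return $\{(q_1,\lambda_1),\ldots,(q_m,\lambda_m)\}$, where $q_i$ is obtained from $\ell_i$ by substituting $Y_j\mapsto u_j$ for all $j$. ''Efficiently'' means: aside from calls to an SDP solver, which is treated as a blackbox, the algorithm uses only basic linear-algebraic operations on polynomially-sized quantities constructed from the input; numerical issues are ignored. *)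

(* Defs.v *)
From HB Require Import structures.
From mathcomp Require Import all_boot all_order all_algebra.
(* mpoly has to be imported before mathcomp-analysis: in the other order their
   notations clash. *)
From mathcomp Require Import mpoly.
From mathcomp Require Import all_classical all_reals all_analysis.

Set Implicit Arguments.
Unset Strict Implicit.
Unset Printing Implicit Defensive.

Import Order.TTheory GRing.Theory Num.Theory.

Local Open Scope classical_set_scope.
Local Open Scope ring_scope.

(* Degree-[d] monomials in [n] variables are enumerated through the sorted
   [d]-tuples of variable indices ([mpoly.basis]). *)
Definition nmon (n d : nat) : nat := #|mpoly.basis n d|.

Definition vars n d (i : 'I_(nmon n d)) : d.-tuple 'I_n := enum_val i.

Definition mon n d (i : 'I_(nmon n d)) : 'X_{1..n} := s2m (vars i).

Lemma mdeg_mon n d (i : 'I_(nmon n d)) : mdeg (mon i) = d.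
Proof.
apply/eqP; rewrite basis_cover; apply/mapP; exists (vars i) => //.
by rewrite mem_enum enum_valP.
Qed.

Section Forms.
Variables (R : realType) (n : nat).

(* The column vector [X]_d of all monomials of degree [d]. *)
Definition monvec d : 'cV[{mpoly R[n]}]_(nmon n d) := \col_i 'X_[mon i].

Definition vform_mpoly d (c : 'cV[R]_(nmon n d)) : {mpoly R[n]} :=
  \sum_i c i 0 *: 'X_[mon i].

Lemma vform_homog d (c : 'cV[R]_(nmon n d)) : vform_mpoly c \is d.-homog.
Proof.
apply: rpred_sum => i _; apply: rpredZ.
by rewrite dhomogX; apply/eqP; exact: mdeg_mon.
Qed.

(* The form [X]_d^T c with coefficient vector [c]. *)
Definition vform d (c : 'cV[R]_(nmon n d)) : dhomog n R d :=
  DHomog (vform_homog c).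

Definition coefs d (f : dhomog n R d) : 'cV[R]_(nmon n d) :=
  \col_i (f : {mpoly R[n]})@_(mon i).

(* Sums of squares of forms of degree [k]. *)
Definition is_sos k (f : {mpoly R[n]}) : Prop :=
  exists s : seq (dhomog n R k), f = \sum_(q <- s) (q : {mpoly R[n]}) ^+ 2.

(* A linear subspace if [f] is a sum of squares, and empty otherwise. *)
Definition sosupp k (f : dhomog n R (2 * k)) : set (dhomog n R k) :=
  [set p | exists2 l : R, 0 < l &
     is_sos k ((f : {mpoly R[n]}) - l *: (p : {mpoly R[n]}) ^+ 2)].

Definition psd d (G : 'M[R]_d) : Prop :=
  G^T = G /\ forall x : 'cV[R]_d, 0 <= (x^T *m G *m x) 0 0.

Definition Gram k (f : dhomog n R (2 * k)) : set 'M[R]_(nmon n k) :=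
  [set G | psd G /\
     ((monvec k)^T *m map_mx (@mpolyC n R) G *m monvec k) 0 0 = f].

End Forms.

Section LinearAndConvex.
Variable R : realType.

Definition linspan (V : vectType R) (S : set V) : {vspace V} :=
  xget 0%VS [set W : {vspace V} | (forall x, S x -> x \in W) /\
    forall W' : {vspace V}, (forall x, S x -> x \in W') -> (W <= W')%VS].

Lemma linspan_smallest (V : vectType R) (S : set V) :
  (forall x, S x -> x \in linspan S) /\
  forall W : {vspace V}, (forall x, S x -> x \in W) -> (linspan S <= W)%VS.
Proof.
apply: (@xgetPex _ 0%VS [set W : {vspace V} | (forall x, S x -> x \in W) /\
  forall W' : {vspace V}, (forall x, S x -> x \in W') -> (W <= W')%VS]).
have [W [SW minW]] : exists W : {vspace V}, (forall x, S x -> x \in W) /\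
  forall W' : {vspace V}, (forall x, S x -> x \in W') -> (W <= W')%VS; last first.
  by exists W.
pose P d := `[< exists W : {vspace V},
  (forall x, S x -> x \in W) /\ \dim W = d >].
have exP : exists d, P d.
  by exists (\dim {:V}); apply/asboolP; exists fullv; split => // x; rewrite memvf.
case: (ex_minnP exP) => d /asboolP [W [SW dW]] mind.
exists W; split => // W' SW'; apply/capv_idPl/eqP.
rewrite eqEdim capvSl dW; apply: mind; apply/asboolP.
by exists (W :&: W')%VS; split => // x Sx; rewrite memv_cap SW ?SW'.
Qed.

Definition affine_hull p q (C : set 'M[R]_(p, q)) : set 'M[R]_(p, q) :=
  [set x | exists s : seq (R * 'M[R]_(p, q)),
     [/\ forall c, c \in s -> C c.2, \sum_(c <- s) c.1 = 1 &
         x = \sum_(c <- s) c.1 *: c.2]].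

Definition relint p q (C : set 'M[R]_(p, q)) : set 'M[R]_(p, q) :=
  [set x | C x /\ exists2 e : R, 0 < e & forall y, affine_hull C y ->
     (forall i j, `|y i j - x i j| < e) -> C y].

End LinearAndConvex.

Definition triple_products (R : realType) n k (U : {vspace dhomog n.+1 R k}) :
    set (dhomog n.+1 R (3 * k)) :=
  [set p | exists u v w : dhomog n.+1 R k, [/\ u \in U, v \in U, w \in U &
     (p : {mpoly R[n.+1]}) = (u : {mpoly R[n.+1]}) * v * w]].

Section POF.
Variables (R : realType) (n k : nat).
Variables (f2 : dhomog n.+1 R (2 * k)) (f3 : dhomog n.+1 R (3 * k)).

Implicit Types s t : seq (dhomog n.+1 R k * R).

Definition powers_sum s : Prop :=
  (f2 : {mpoly R[n.+1]}) =
    \sum_(c <- s) c.2 *: (c.1 : {mpoly R[n.+1]}) ^+ 2 /\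
  (f3 : {mpoly R[n.+1]}) =
    \sum_(c <- s) c.2 *: (c.1 : {mpoly R[n.+1]}) ^+ 3.

(* A list of pairs (q_i, lambda_i). *)
Definition pof_decomp s : Prop :=
  (forall c, c \in s -> 0 <= c.2) /\ powers_sum s.

Definition indep_pof_decomp s : Prop :=
  [/\ (0 < size s)%N, forall c, c \in s -> 0 < c.2,
      free [seq c.1 | c <- s] & powers_sum s].

Definition min_rank_pof_decomp s : Prop :=
  pof_decomp s /\ forall t, pof_decomp t -> (size s <= size t)%N.

End POF.

(* Lebesgue measure on Borel sets of R^N, as an iterated product of the
   one-dimensional Lebesgue measure. *)
Fixpoint lebesgue_tuple (R : realType) (N : nat) :
    set (N.-tuple (measurableTypeR R)) -> \bar R :=
  match N with
  | 0 => fun A => \d_([tuple] : 0.-tuple (measurableTypeR R)) A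
  | N'.+1 => fun A =>
      (@lebesgue_measure R \x @lebesgue_tuple R N')%E
        [set xt : measurableTypeR R * N'.-tuple (measurableTypeR R) |
          A [tuple of xt.1 :: xt.2]]
  end.

(* Absolutely continuous with respect to Lebesgue measure. *)
Definition continuous_distribution (R : realType) (N : nat)
    (P : probability (N.-tuple (measurableTypeR R)) R) : Prop :=
  forall A, measurable A -> lebesgue_tuple A = 0%E -> P A = 0%E.

(* Randomized linear-algebra programs with an SDP oracle. A program has no
   access to the scalars except through [op]: the type [V] of scalars is a
   parameter, so the only data that can influence the control flow are the
   sizes of the answers and the solvability of the subproblems. Moving scalars
   between matrices is free. *)
Inductive op (V : Type) : Type :=
  | Const (p q : nat) (C : 'M[rat]_(p, q))
  | Mul (p q r : nat) (A : 'M[V]_(p, q)) (B : 'M[V]_(q, r))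
  | Solve (p q : nat) (A : 'M[V]_(p, q)) (b : 'cV[V]_p)
  | Image (p q : nat) (A : 'M[V]_(p, q))
  | GenEig (m : nat) (A B : 'M[V]_m)
  | Random (N : nat)
  | GramSDP (n k : nat) (f : 'cV[V]_(nmon n (2 * k))).

Arguments Const {V p q} C.
Arguments Random {V} N.
Arguments GramSDP {V n k} f.

(* [None] stands for the answer that the subproblem has no solution. *)
Definition answer (V : Type) (o : op V) : Type :=
  match o with
  | @Const _ p q _ => 'M[V]_(p, q)
  | @Mul _ p _ r _ _ => 'M[V]_(p, r)
  | @Solve _ _ q _ _ => option 'cV[V]_q
  | @Image _ p _ _ => {r : nat & 'M[V]_(p, r)}
  | @GenEig _ m _ _ => option ('rV[V]_m * 'M[V]_m)
  | Random N => N.-tuple V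
  | @GramSDP _ n k _ => option 'M[V]_(nmon n k)
  end.

Definition correct (R : realType) (o : op R) : answer o -> Prop :=
  match o with
  | Const _ _ C => fun B => B = map_mx ratr C
  | Mul _ _ _ A B => fun C => C = A *m B
  | Solve _ _ A b => fun x =>
      if x is Some x then A *m x = b else forall x, A *m x <> b
  (* the columns of the answer form a basis of the column space of A *)
  | Image _ _ A => fun B =>
      row_free (projT2 B)^T && ((projT2 B)^T == A^T)%MS
  (* A x_j = mu_j B x_j for a basis of eigenvectors x_j, the columns of X *)
  | GenEig _ A B => fun z =>
      let eigenbasis (mu : 'rV[R]_ _) X :=
        X \in unitmx /\ A *m X = B *m X *m diag_mx mu in
      if z is Some (mu, X) then eigenbasis mu X
      else forall mu X, ~ eigenbasis mu X
  | Random _ => fun _ => True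
  | GramSDP _ _ f => fun G =>
      if G is Some G then relint (Gram (vform f)) G else Gram (vform f) = set0
  end.

(* Total number of entries of the operands and of the answer. *)
Definition op_size (V : Type) (o : op V) : answer o -> nat :=
  match o with
  | @Const _ p q _ => fun _ => p * q
  | @Mul _ p q r _ _ => fun _ => p * q + q * r + p * r
  | @Solve _ p q _ _ => fun _ => p * q + p + q
  | @Image _ p q _ => fun B => p * q + p * projT1 B
  | @GenEig _ m _ _ => fun _ => m * m + m * m + (m + m * m)
  | Random N => fun _ => N
  | @GramSDP _ n k _ => fun _ => nmon n (2 * k) + nmon n k * nmon n k
  end%N.

Inductive prog (V A : Type) : Type :=
  | Ret (a : A)
  | Fail
  | Call (o : op V) (next : answer o -> prog V A).

Arguments Ret {V A} a.
Arguments Fail {V A}.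

Fixpoint bind V A B (p : prog V A) (f : A -> prog V B) : prog V B :=
  match p with
  | Ret a => f a
  | Fail => Fail
  | Call o next => Call (fun r => bind (next r) f)
  end.

Definition call V (o : op V) : prog V (answer o) := Call (fun r => Ret r).

Definition succeed {V A : Type} (x : option A) : prog V A :=
  if x is Some a then Ret a else Fail.

Notation "'let*' x ':=' p 'in' q" := (bind p (fun x => q))
  (at level 200, x name, p at level 100, q at level 200,
   format "'[v' 'let*'  x  ':='  p  'in' '/' q ']'").

Fixpoint columns V p m : ('I_m -> prog V 'cV[V]_p) -> prog V 'M[V]_(p, m) :=
  match m return ('I_m -> prog V 'cV[V]_p) -> prog V 'M[V]_(p, m) with
  | 0 => fun _ => Ret (\matrix_(i < p, j < 0) False_rect V (notF (ltn_ord j)))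
  | m'.+1 => fun f =>
      let* x := f ord0 in
      let* A := columns (fun j => f (lift ord0 j)) in
      Ret (\matrix_(i, j) if unlift ord0 j is Some j' then A i j' else x i 0)
  end.

(* For every correct sequence of answers, and almost surely for the random
   vectors, whatever continuous distributions they are drawn from, the program
   does not fail and its result satisfies [Q]. *)
Definition op_almost_surely (R : realType) (o : op R) :
    (answer o -> Prop) -> Prop :=
  match o return (answer o -> Prop) -> Prop with
  | Random N => fun K =>
      forall P : probability (N.-tuple (measurableTypeR R)) R,
        continuous_distribution P -> {ae P, forall v, K v}
  | o => fun K => (exists r, @correct R o r) /\ forall r, @correct R o r -> K r
  end.

Fixpoint almost_surely (R : realType) A (p : prog R A) (Q : A -> Prop) : Prop :=
  match p with
  | Ret a => Q a
  | Fail => False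
  | Call o next => op_almost_surely (fun r => almost_surely (next r) Q)
  end.

(* In every run the number of operations plus the total size of their operands
   and answers is at most [b]. *)
Fixpoint cost_le (R : realType) A (p : prog R A) (b : nat) : Prop :=
  match p with
  | Call o next => forall r, @correct R o r ->
      (op_size r < b)%N /\ cost_le (next r) (b - (op_size r).+1)
  | _ => True
  end.

Section AlgorithmP.
Variable V : Type.

(* The product of forms is linear in the second factor; its matrix is filled
   with the coefficients of the first one. *)
Definition form_mul n a b (p : 'cV[V]_(nmon n a)) (q : 'cV[V]_(nmon n b)) :
    prog V 'cV[V]_(nmon n (a + b)) :=
  let* z := call (Const (0 : 'M[rat]_1)) in
  call (Mul (\matrix_(g < nmon n (a + b), j < nmon n b)
    if [pick i : 'I_(nmon n a) | (mon i + mon j == mon g)%MM] is Some i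
    then p i 0 else z 0 0) q).

(* u_(t_1) * ... * u_(t_d), where the u_i are the columns of [U]. *)
Fixpoint form_prod n k N (U : 'M[V]_(nmon n k, N)) d :
    d.-tuple 'I_N -> prog V 'cV[V]_(nmon n (d * k)) :=
  match d return d.-tuple 'I_N -> prog V 'cV[V]_(nmon n (d * k)) with
  | 0 => fun _ => call (Const (const_mx 1))
  | d'.+1 => fun t =>
      let* p := form_prod U (behead_tuple t) in
      form_mul (col (thead t) U) p
  end.

(* The coefficients (c_alpha) of f = sum_(|alpha| = d) c_alpha u^alpha. *)
Definition express n k N (U : 'M[V]_(nmon n k, N)) d
    (f : 'cV[V]_(nmon n (d * k))) : prog V 'cV[V]_(nmon N d) :=
  let* A := columns (fun i : 'I_(nmon N d) => form_prod U (vars i)) in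
  let* c := call (Solve A f) in
  succeed c.

Arguments express {n k N} U d f.

Definition partial_mx N d (j : 'I_N) : 'M[rat]_(nmon N d, nmon N d.+1) :=
  \matrix_(b, a)
    if (mon a == mon b + U_(j))%MM then (mon a j)%:R else 0.

(* Column j is the j-th partial derivative of [g]; the derivative of [g] in the
   direction v is the product of this matrix with v. *)
Definition partials N d (g : 'cV[V]_(nmon N d.+1)) :
    prog V 'M[V]_(nmon N d, N) :=
  columns (fun j =>
    let* C := call (Const (partial_mx d j)) in
    call (Mul C g)).

(* The symmetric matrix M with g = w^T M w, when g = sum_alpha c_alpha w^alpha:
   the coefficients of the mixed products are halved. *)
Definition sym_matrix m (c : 'cV[V]_(nmon m 2)) : prog V 'M[V]_m :=
  let* D := call (Const (diag_mx (\row_(a < nmon m 2)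
                    if constant (vars a) then 1 else 2%:R^-1))) in
  let* h := call (Mul D c) in
  let* z := call (Const (0 : 'M[rat]_1)) in
  Ret (\matrix_(i, j)
    if [pick a | mon a == (U_(i) + U_(j))%MM] is Some a then h a 0 else z 0 0).

(* Linear forms in Y_1, ..., Y_N are represented, as all forms, by their
   coefficients with respect to the monomials of degree 1; the [i]-th such
   monomial is the variable of index [var1 i]. *)
Definition var1 N (i : 'I_(nmon N 1)) : 'I_N := thead (vars i).

(* Computes linear forms l_j and weights lambda_j with
   g_d = sum_j lambda_j l_j^d for d = 2, 3. The columns of [W] are a basis w of
   the space of directional derivatives of g2, g2 = w^T M w, and the derivative
   of g3 / 3 in the random direction v is w^T Mv w. The columns of [B] are
   b_j = M x_j, those of [A] are a_j = mu_j / (b_j^T w(v)) b_j, and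
   l_j = a_j^T w are the columns of [L]. *)
Definition decompose_linear N (g2 : 'cV[V]_(nmon N 2))
    (g3 : 'cV[V]_(nmon N 3)) :
    prog V {m : nat & ('M[V]_(nmon N 1, m) * 'cV[V]_m)%type} :=
  let* J2 := partials g2 in
  let* im := call (Image J2) in
  let m := projT1 im in
  let W : 'M[V]_(nmon N 1, m) := projT2 im in
  let* v := call (Random N) in
  let* c2 := express W 2 g2 in
  let* M := sym_matrix c2 in
  let* J3 := partials g3 in
  let* h := call (Mul J3 (\col_j tnth v j)) in
  let* third := call (Const (3%:R^-1)%:M) in
  let* h3 := call (Mul h third) in
  let* c3 := express W 2 h3 in
  let* Mv := sym_matrix c3 in
  let* eig := call (GenEig Mv M) in
  let* muX := succeed eig in
  let mu : 'rV[V]_m := muX.1 in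
  let* B := call (Mul M muX.2) in
  let* wv := call (Mul (\row_i tnth v (var1 i)) W) in
  let* bwv := call (Mul wv B) in
  let* A := columns (fun j =>
    let* y := call (Solve (\matrix_(_ < 1, _ < 1) bwv 0 j) (\col_(_ < 1) mu 0 j)) in
    let* c := succeed y in
    call (Mul (col j B) c)) in
  let* L := call (Mul W A) in
  let* S := columns (fun j => form_mul (col j L) (col j L)) in
  let* y := call (Solve S g2) in
  let* lambda := succeed y in
  Ret (existT _ m (L, lambda)).

(* G is a relative interior point of Gram(f2), the columns of [U] are a basis u
   of its image, and f_d = g_d(u) for d = 2, 3; the result is obtained by
   substituting u_j for Y_j in the linear forms of the decomposition of
   (g2, g3). *)
Definition algorithmP n k (f2 : 'cV[V]_(nmon n (2 * k)))
    (f3 : 'cV[V]_(nmon n (3 * k))) : prog V (seq ('cV[V]_(nmon n k) * V)) :=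
  let* oG := call (GramSDP f2) in
  let* G := succeed oG in
  let* im := call (Image G) in
  let U := projT2 im in
  let* g2 := express U 2 f2 in
  let* g3 := express U 3 f3 in
  let* dec := decompose_linear g2 g3 in
  let: existT m (L, lambda) := dec in
  let* Q := call (Mul (\matrix_(i, j) U i (var1 j)) L) in
  Ret [seq (col j Q, lambda j 0) | j <- enum 'I_m].

End AlgorithmP.

(* Main.v *)
(* If f2 = sum_i lambda_i q_i^2 with positive weights, then U = sosupp f2 is
   the span of the q_i: in a sum of squares equal to f2 all summands lie in U,
   and products of pairs from a basis of U are independent, so two such
   representations are congruent as quadratic forms and have the same row space.
   In the basis q the pair (f2, f3) becomes (sum lambda_i Y_i^2,
   sum lambda_i Y_i^3). If it is also sum_j mu_j l_j^d for d = 2, 3, comparing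
   the squares with the directional derivatives of the cubes gives
   a_ji (l_j - Y_i) = 0 for the coefficients a_ji of l_j, so each l_j is a
   variable. The independence of products also makes Gram(f2) a single point, so
   the relative interior point found by the solver is known exactly. The
   generalized eigenvalues in Algorithm P are the values l_i(v); they are
   nonzero and distinct unless v lies in one of finitely many hyperplanes, and
   then the eigenvectors determine the l_i. *)
Require Import Defs.
From HB Require Import structures.
From mathcomp Require Import all_boot all_order all_algebra.
From mathcomp Require Import mpoly.
From mathcomp Require Import all_classical all_reals all_analysis.
From mathcomp Require Import measurable_realfun.
From mathcomp Require Import ring lra zify.

Set Implicit Arguments.
Unset Strict Implicit.
Unset Printing Implicit Defensive.

Import Order.TTheory GRing.Theory Num.Theory.

Local Open Scope classical_set_scope.
Local Open Scope ring_scope.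

(** * Forms and their coefficient vectors *)

(** The dimension hypothesis enters in one shape only: C(N+2,3) counts the cubic monomials in N
    variables, so substituting a basis of U for the variables Y is injective on cubic forms.
    Multiplication by a variable passes this down to degrees 2 and 1. Identities among products of
    forms in U can then be pulled back to polynomial identities in Y, where quadratic forms are
    symmetric matrices.

    The obstacle in the correctness proof is that answers are not determined: [Image] returns any
    basis, [GenEig] any eigenbasis in any order and scaling, [Solve] any solution. Each call
    therefore needs a proof that a correct answer exists and a description of all of them. The bases
    are absorbed by two change-of-basis matrices, both called [P], the order of the eigenvectors by
    a permutation [s], and their scaling cancels in the definition of a_j. The linear systems turn
    out to have unique solutions. *)

Section Forms.
Variable R : realType.
Implicit Types n d : nat.

Lemma mon_inj n d : injective (@mon n d).
Proof.
move=> i j eqij; apply: enum_val_inj; apply: (@inj_s2m n d) eqij; exact: enum_valP.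
Qed.

Lemma monP n d (m : 'X_{1..n}) :
  mdeg m = d -> exists i : 'I_(nmon n d), mon i = m.
Proof.
move=> /eqP; rewrite basis_cover => /mapP[t]; rewrite mem_enum => tb ->.
by exists (enum_rank_in tb t); rewrite /mon /vars enum_rankK_in.
Qed.

Lemma homog_eq n d (p q : {mpoly R[n]}) : p \is d.-homog -> q \is d.-homog ->
  (forall i : 'I_(nmon n d), p@_(mon i) = q@_(mon i)) -> p = q.
Proof.
move=> hp hq epq; apply/mpolyP => m; have [/monP[i <-]//|/eqP nd] := eqVneq (mdeg m) d.
by rewrite (dhomog_nemf_coeff hp) ?(dhomog_nemf_coeff hq)//; apply/eqP.
Qed.

Lemma vform_mpoly_is_linear n d : linear (@vform_mpoly R n d).
Proof.
move=> a c c'; rewrite /vform_mpoly scaler_sumr -big_split; apply: eq_bigr => i _.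
by rewrite !mxE scalerDl scalerA.
Qed.

HB.instance Definition _ n d := GRing.isLinear.Build R 'cV[R]_(nmon n d)
  {mpoly R[n]} _ (@vform_mpoly R n d) (@vform_mpoly_is_linear n d).

Lemma mcoeff_vform n d (c : 'cV[R]_(nmon n d)) i :
  (vform_mpoly c)@_(mon i) = c i 0.
Proof.
rewrite raddf_sum /= (bigD1 i) //= mcoeffZ mcoeffX eqxx mulr1 big1 ?addr0// => j ji.
by rewrite mcoeffZ mcoeffX (inj_eq (@mon_inj n d)) (negbTE ji) mulr0.
Qed.

Lemma vform_mpoly_inj n d : injective (@vform_mpoly R n d).
Proof.
by move=> c c' e; apply/colP => i; rewrite -!mcoeff_vform e.
Qed.

Lemma coefsK n d (f : dhomog n R d) : vform_mpoly (coefs f) = f.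
Proof.
apply: (@homog_eq _ d); rewrite ?vform_homog//; first exact: dhomog_is_dhomog.
by move=> i; rewrite mcoeff_vform mxE.
Qed.

Lemma vform_coefs n d (f : dhomog n R d) : vform (coefs f) = f.
Proof. by apply: val_inj; exact: coefsK. Qed.

Lemma homog_vform n d (p : {mpoly R[n]}) :
  p \is d.-homog -> exists c : 'cV_(nmon n d), vform_mpoly c = p.
Proof. by move=> hp; exists (coefs (DHomog hp)); rewrite coefsK. Qed.

Lemma vform_mulmx n d m (A : 'M[R]_(nmon n d, m)) (x : 'cV_m) :
  vform_mpoly (A *m x) = \sum_j x j 0 *: vform_mpoly (col j A).
Proof.
have -> : A *m x = \sum_j x j 0 *: col j A.
  apply/colP => i; rewrite summxE mxE; apply: eq_bigr => j _.
  by rewrite !mxE mulrC.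
rewrite raddf_sum; apply: eq_bigr => j _; exact: linearZ.
Qed.

Definition forms n d N (U : 'M[R]_(nmon n d, N)) : N.-tuple {mpoly R[n]} :=
  [tuple vform_mpoly (col j U) | j < N].

Lemma mpolyX_vars n (t : seq 'I_n) : 'X_[R, s2m t] = \prod_(x <- t) 'X_x.
Proof.
elim: t => [|x t IH].
  rewrite big_nil -mpolyX0; congr mpolyX; apply/mnmP => i; by rewrite mnmE mnm0E.
rewrite big_cons -IH -mpolyXD; congr mpolyX; apply/mnmP => i.
by rewrite mnmDE !mnmE /= eq_sym.
Qed.

Lemma comp_vform_tuple n N d (u : N.-tuple {mpoly R[n]}) (c : 'cV[R]_(nmon N d)) :
  vform_mpoly c \mPo u = \sum_i c i 0 *: \prod_(x <- vars i) tnth u x.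
Proof.
rewrite raddf_sum /=; apply: eq_bigr => i _; rewrite comp_mpolyZ; congr (_ *: _).
rewrite /mon mpolyX_vars rmorph_prod /=; apply: eq_bigr => x _.
by rewrite comp_mpolyXU -tnth_nth.
Qed.

Lemma comp_vform n d N e (U : 'M[R]_(nmon n e, N)) (c : 'cV[R]_(nmon N d)) :
  vform_mpoly c \mPo forms U =
  \sum_i c i 0 *: \prod_(x <- vars i) vform_mpoly (col x U).
Proof.
rewrite comp_vform_tuple; apply: eq_bigr => i _; congr (_ *: _).
by apply: eq_bigr => x _; rewrite tnth_mktuple.
Qed.

End Forms.

(** * Almost sure correctness of programs *)

Section ProgramLogic.
Variable R : realType.

Lemma op_almost_surely_mono (o : op R) (K K' : answer o -> Prop) :
  (forall r, K r -> K' r) -> op_almost_surely K -> op_almost_surely K'.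
Proof.
move=> KK'; case: o K K' KK' => /= [p q C|p q r A B|p q A b|p q A|m A B|N|n k f] K K' KK';
  try by move=> [e h]; split=> [|x cx]; [exact: e|apply: (KK' x); exact: (h x cx)].
move=> h P cP; apply: negligibleS (h P cP) => v nK Kv; exact: nK (KK' v Kv).
Qed.

Lemma as_bind A B (p : prog R A) (f : A -> prog R B) Q Q' :
  almost_surely p Q -> (forall a, Q a -> almost_surely (f a) Q') ->
  almost_surely (bind p f) Q'.
Proof.
elim: p => [a|//|o next IH] /=; first by move=> Qa; apply.
move=> h Qf; apply: op_almost_surely_mono h => r h; exact: IH.
Qed.

Lemma as_mono A (p : prog R A) (Q Q' : A -> Prop) :
  (forall a, Q a -> Q' a) -> almost_surely p Q -> almost_surely p Q'.
Proof.
move=> QQ'; elim: p => [a /QQ'//|//|o next IH] /=.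
apply: op_almost_surely_mono => r; exact: IH.
Qed.

Variable B : Type.

Lemma as_const p q (C : 'M[rat]_(p, q)) (f : 'M[R]_(p, q) -> prog R B) Q :
  almost_surely (f (map_mx ratr C)) Q -> almost_surely (bind (call (Const C)) f) Q.
Proof. by move=> h /=; split=> [|r ->//]; exists (map_mx ratr C). Qed.

Lemma as_mul p q r (A : 'M[R]_(p, q)) (A' : 'M[R]_(q, r)) (f : 'M[R]_(p, r) -> prog R B) Q :
  almost_surely (f (A *m A')) Q -> almost_surely (bind (call (Mul A A')) f) Q.
Proof. by move=> h /=; split=> [|C ->//]; exists (A *m A'). Qed.

(** Solvability excludes the answer [None]; after that every solution has to be treated, since any
    of them may be returned. *)
Lemma as_solve p q (A : 'M[R]_(p, q)) b (f : option 'cV[R]_q -> prog R B) Q :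
  (exists x, A *m x = b) ->
  (forall x, A *m x = b -> almost_surely (f (Some x)) Q) ->
  almost_surely (bind (call (Solve A b)) f) Q.
Proof.
move=> [x Ax] h /=; split; first by exists (Some x).
by case=> [y /h//|/(_ x)/(_ Ax)].
Qed.

Lemma as_image p q (A : 'M[R]_(p, q)) (f : {r : nat & 'M[R]_(p, r)} -> prog R B) Q :
  (forall r (W : 'M[R]_(p, r)), row_free W^T -> (W^T == A^T)%MS ->
    almost_surely (f (existT _ r W)) Q) ->
  almost_surely (bind (call (Image A)) f) Q.
Proof.
move=> h /=; split; last by case=> r W /= /andP[]; exact: h.
exists (existT _ _ (row_base A^T)^T) => /=; rewrite trmxK row_base_free /=.
exact/eqmxP/eq_row_base.
Qed.

Lemma as_eig m (A M : 'M[R]_m) (f : option ('rV[R]_m * 'M[R]_m) -> prog R B) Q :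
  (exists mu X, X \in unitmx /\ A *m X = M *m X *m diag_mx mu) ->
  (forall mu X, X \in unitmx -> A *m X = M *m X *m diag_mx mu ->
     almost_surely (f (Some (mu, X))) Q) ->
  almost_surely (bind (call (GenEig A M)) f) Q.
Proof.
move=> [mu [X h]] H /=; split; first by exists (Some (mu, X)).
by case=> [[mu' X'] []|/(_ mu X)/(_ h)//]; exact: H.
Qed.

Lemma as_columns p m (f : 'I_m -> prog R 'cV[R]_p) (Q : 'I_m -> 'cV[R]_p -> Prop) :
  (forall j, almost_surely (f j) (Q j)) ->
  almost_surely (columns f) (fun A => forall j, Q j (col j A)).
Proof.
elim: m f Q => [|m IH] f Q Qf /=; first by case.
apply: as_bind (Qf ord0) _ => x Qx.
apply: as_bind (IH _ (fun j => Q (lift ord0 j)) _) _ => [j|A QA]; first exact: Qf.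
move=> j /=; case: (unliftP ord0 j) => [j'|] ->.
  congr (Q _ _): (QA j'); apply/colP => i; by rewrite !mxE liftK.
congr (Q _ _): Qx; apply/colP => i; by rewrite !mxE unlift_none.
Qed.

End ProgramLogic.

(** * Subroutines of Algorithm P *)

Section Subroutines.
Variable R : realType.

Lemma as_call_mul p q r (A : 'M[R]_(p, q)) (B : 'M[R]_(q, r)) Q :
  Q (A *m B) -> almost_surely (call (Mul A B)) Q.
Proof. by move=> h /=; split=> [|C ->//]; exists (A *m B). Qed.

Lemma map_mx_ratr0 p q : map_mx ratr (0 : 'M[rat]_(p, q)) = 0 :> 'M[R]_(p, q).
Proof. by apply/matrixP => i j; rewrite !mxE rmorph0. Qed.

Lemma form_mulP n a b (p : 'cV[R]_(nmon n a)) (q : 'cV[R]_(nmon n b)) :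
  almost_surely (form_mul p q)
    (fun r => vform_mpoly r = vform_mpoly p * vform_mpoly q).
Proof.
rewrite /form_mul; apply: as_const; apply: as_call_mul.
apply: (@homog_eq _ _ (a + b)); first exact: vform_homog.
  exact: dhomogM (vform_homog p) (vform_homog q).
move=> g; rewrite mcoeff_vform mxE [in RHS]/vform_mpoly mulr_suml raddf_sum /=.
under [RHS]eq_bigr => i _ do rewrite mulr_sumr raddf_sum /=.
rewrite exchange_big /=; apply: eq_bigr => j _; rewrite mxE map_mx_ratr0.
have E i : (p i 0 *: 'X_[mon i] * (q j 0 *: 'X_[mon j]))@_(mon g) =
    p i 0 * q j 0 * ((mon i + mon j)%MM == mon g)%:R.
  by rewrite -scalerAl -scalerAr -mpolyXD !mcoeffZ mcoeffX mulrA.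
under eq_bigr do rewrite E.
(* Exponents cancel, so at most one [i] satisfies mon i + mon j = mon g; the picked one carries the
   whole inner sum. *)
case: pickP => [i /eqP ei|none].
  rewrite (bigD1 i) //= ei eqxx mulr1 big1 ?addr0// => i' ii'.
  have [e|_] := eqVneq (mon i' + mon j)%MM (mon g); last by rewrite mulr0.
  case/eqP: ii'; apply: (@mon_inj n a); apply/mnmP => x.
  by move/mnmP: ei => /(_ x); rewrite -e !mnmDE => /addIn.
rewrite mxE mul0r big1// => i _; move: (none i) => /= ->; by rewrite mulr0.
Qed.

Lemma form_prodP n k N (U : 'M[R]_(nmon n k, N)) d (t : d.-tuple 'I_N) :
  almost_surely (form_prod U t)
    (fun r => vform_mpoly r = \prod_(x <- t) vform_mpoly (col x U)).
Proof.
elim: d t => [|d IH] t.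
  split=> [|r /= ->]; first by exists (map_mx ratr (const_mx 1)).
  rewrite tuple0 big_nil; apply: (@homog_eq _ _ (0 * k)); first exact: vform_homog.
    exact: dhomog1.
  move=> i; rewrite mcoeff_vform !mxE rmorph1 mcoeff1 -mdeg_eq0.
  by rewrite (mdeg_mon i).
rewrite /=; apply: as_bind (IH (behead_tuple t)) _ => p ep.
apply: as_mono (form_mulP _ _) => r ->.
by rewrite ep [in RHS](tuple_eta t) big_cons.
Qed.

(** The candidate [g] shows that the system is solvable, and injectivity of the substitution in
    degree [d] makes it the only solution, hence the answer. *)
Lemma expressP n k N (U : 'M[R]_(nmon n k, N)) d (f : 'cV[R]_(nmon n (d * k)))
    (g : {mpoly R[N]}) :
  g \is d.-homog -> g \mPo forms U = vform_mpoly f ->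
  (forall h : {mpoly R[N]}, h \is d.-homog -> h \mPo forms U = 0 -> h = 0) ->
  almost_surely (express U f) (fun c => vform_mpoly c = g).
Proof.
move=> hg gU inj; rewrite /express.
apply: as_bind.
  apply: (as_columns (Q := fun i x =>
     vform_mpoly x = \prod_(j <- vars i) vform_mpoly (col j U))) => j.
  exact: form_prodP.
move=> A colA.
have AE c : vform_mpoly (A *m c) = vform_mpoly c \mPo forms U.
  by rewrite vform_mulmx comp_vform; apply: eq_bigr => j _; rewrite colA.
have [c ec] := homog_vform hg.
apply: as_solve => [|x Ax /=]; first by exists c; apply: vform_mpoly_inj; rewrite AE ec.
apply/eqP; rewrite -subr_eq0; apply/eqP/inj.
  by rewrite rpredB// vform_homog.
by rewrite raddfB /= gU -AE Ax subrr.
Qed.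

Lemma mderiv_homog n d (p : {mpoly R[n]}) j : p \is d.+1.-homog -> p^`M(j) \is d.-homog.
Proof.
move=> hp; apply/dhomogP => m; rewrite mcoeff_msupp mcoeff_deriv => nz.
apply/eqP; rewrite -eqSS; apply/eqP.
have : p@_(m + U_(j)) != 0 by apply: contraNneq nz => ->; rewrite mul0rn.
rewrite -mcoeff_msupp => /(dhomog_mf hp) e.
have : mdeg (m + U_(j))%MM = d.+1 := e.
by rewrite mdegD mdeg1 addn1.
Qed.

Lemma partialsP N d (g : 'cV[R]_(nmon N d.+1)) :
  almost_surely (partials g)
    (fun J => forall j, vform_mpoly (col j J) = (vform_mpoly g)^`M(j)).
Proof.
apply: (as_columns (Q := fun j x => vform_mpoly x = _^`M(j))) => j.
apply: as_const; apply: as_call_mul.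
apply: (@homog_eq _ _ d); first exact: vform_homog.
  exact/mderiv_homog/vform_homog.
move=> b; rewrite mcoeff_vform mxE mcoeff_deriv.
have [a ea] : exists a : 'I_(nmon N d.+1), mon a = (mon b + U_(j))%MM.
  by apply: monP; rewrite mdegD mdeg1 mdeg_mon addn1.
rewrite (bigD1 a) //= -ea mcoeff_vform big1 => [|a' aa'].
  rewrite !mxE ea eqxx ratr_nat addr0 mulr_natl mnmDE mnm1E eqxx.
  by rewrite addn1.
by rewrite !mxE -ea (inj_eq (@mon_inj _ _)) (negbTE aa') rmorph0 mul0r.
Qed.

Lemma mnm2_eq n (i j x y : 'I_n) : ((U_(i) + U_(j))%MM == (U_(x) + U_(y))%MM) =
  ((i, j) == (x, y)) || ((i, j) == (y, x)).
Proof.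
apply/eqP/orP => [e|[/eqP[-> ->]//|/eqP[-> ->]]]; last by rewrite addmC.
have E z : ((i == z) + (j == z) = (x == z) + (y == z))%N.
  by move/mnmP: e => /(_ z); rewrite !mnmDE !mnm1E.
case: (eqVneq i x) => [ix|ix].
  left; move: (E y); rewrite ix eqxx => /addnI; by case: eqVneq => // ->; rewrite eqxx.
have iy : y = i.
  by move: (E i); rewrite eqxx eq_sym in ix *; rewrite (negbTE ix); case: (eqVneq y i).
right; move: (E x); rewrite iy eqxx addnC => /addIn.
by case: eqVneq => // ->; rewrite eqxx.
Qed.

Lemma sym_matrixP m (c : 'cV[R]_(nmon m 2)) :
  almost_surely (sym_matrix c)
    (fun M => M^T = M /\ vform_mpoly c = \sum_i \sum_j M i j *: ('X_i * 'X_j)).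
Proof.
apply: as_const; apply: as_mul; apply: as_const => /=.
set D := map_mx ratr _; set Mx := \matrix_(i, j) _.
have ME i j a : mon a = (U_(i) + U_(j))%MM -> Mx i j = (D *m c) a 0.
  move=> ea; rewrite mxE; case: pickP => [b /eqP eb|/(_ a)]; last by rewrite ea eqxx.
  by congr (_ _ 0); apply: (@mon_inj m 2); rewrite eb.
have De a : (D *m c) a 0 = (if constant (vars a) then 1 else 2%:R^-1) * c a 0.
  rewrite mxE (bigD1 a) //= big1 => [|b ba].
    by rewrite !mxE eqxx mulr1n addr0; case: ifP; rewrite ?rmorph1 // fmorphV rmorph_nat.
  by rewrite !mxE eq_sym (negbTE ba) mulr0n rmorph0 mul0r.
split.
  apply/matrixP => i j; rewrite mxE.
  have [a ea] : exists a : 'I_(nmon m 2), mon a = (U_(i) + U_(j))%MM.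
    by apply: monP; rewrite mdegD !mdeg1.
  by rewrite (ME i j a ea) (ME j i a) // addmC.
apply: (@homog_eq _ _ 2); first exact: vform_homog.
  apply: rpred_sum => i _; apply: rpred_sum => j _; apply: rpredZ.
  have e2 : mdeg (U_(i) + U_(j)) = 2%N by rewrite mdegD !mdeg1.
  by rewrite -mpolyXD dhomogX; apply/eqP; exact: e2.
move=> a; rewrite mcoeff_vform.
have [x [y exy]] : exists x y, val (vars a) = [:: x; y].
  by case: (vars a) => [[|x [|y [|? ?]]]] //= ?; exists x, y.
have ea : mon a = (U_(x) + U_(y))%MM.
  rewrite /mon exy; apply/mnmP => z; by rewrite mnmDE !mnm1E mnmE /= addn0.
rewrite raddf_sum /=.
under eq_bigr => i _ do rewrite raddf_sum /=.
rewrite pair_bigA /=.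
under eq_bigr => p _ do
  rewrite mcoeffZ -mpolyXD mcoeffX ea mnm2_eq -!surjective_pairing.
rewrite (bigD1 (x, y)) //= eqxx /= mulr1 (ME x y a ea).
have [exy'|nxy] := eqVneq x y.
  rewrite big1 ?addr0 => [|p pxy]; first by rewrite De exy /= exy' eqxx mul1r.
  by rewrite -exy' in pxy *; rewrite (negbTE pxy) mulr0.
(* For a mixed monomial the entries at (x, y) and (y, x) both contribute; their two halves add up to
   the coefficient. *)
rewrite (bigD1 (y, x)) /=; last by rewrite xpair_eqE eq_sym (negbTE nxy).
have eyx : Mx y x = (D *m c) a 0 by apply: ME; rewrite ea addmC.
rewrite eqxx orbT mulr1 eyx big1 => [|p /andP[p1 p2]].
  rewrite addr0 De exy /= eq_sym (negbTE nxy) /= -mulrDl -[LHS]mul1r.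
  by congr (_ * _); rewrite [LHS]splitr div1r.
by rewrite (negbTE p1) (negbTE p2) mulr0.
Qed.

End Subroutines.

(** * Genericity of random directions *)

Section Hyperplanes.
Variable R : realType.
Notation borelR := (measurableTypeR R).

(** The integral over the line equals the one over {r}, and points are Lebesgue null. *)
Lemma integral_point (f : borelR -> \bar R) (r : R) :
  (forall x, x != r -> f x = 0%E) -> (\int[@lebesgue_measure R]_x f x = 0)%E.
Proof.
move=> f0; rewrite -(integral_set1 f r) [RHS]integral_mkcond; congr integral.
apply/funext => x; rewrite patchE; case: ifPn => // /negP xr.
by apply: f0; apply: contra_notN xr => /eqP ->; rewrite inE.
Qed.

(** [lebesgue_tuple] is only a set function that iterates integrals of sections, so even its value
    on the empty set takes an induction. *)
Lemma lebesgue_tuple0 N : @lebesgue_tuple R N set0 = 0%E.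
Proof.
elim: N => [|N IH] /=; first by rewrite diracE in_set0.
apply: (integral_point (r := 0)) => x _ /=; rewrite -IH; congr lebesgue_tuple.
by apply/seteqP; split=> v //; rewrite /xsection /= inE.
Qed.

Definition hyperplane N (c : 'I_N -> R) (b : R) : set (N.-tuple borelR) :=
  [set v | \sum_i c i * tnth v i = b].

Lemma measurable_hyperplane N (c : 'I_N -> R) b : measurable (hyperplane c b).
Proof.
pose f (v : N.-tuple borelR) : borelR := \sum_i c i * tnth v i.
have mf : measurable_fun setT f.
  apply: measurable_sum => i; apply: measurable_funM; first exact: measurable_cst.
  exact: measurable_tnth.
rewrite (_ : hyperplane c b = setT `&` f @^-1` [set b]); last by rewrite setTI.
by apply: mf => //; exact: measurable_set1.
Qed.

(** Sections along the first coordinate are again level sets of linear functions. If a later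
    coefficient is nonzero, all of them are null by induction; otherwise the hyperplane fixes the
    first coordinate at b / c_0, and all sections but one are empty. *)
Lemma lebesgue_hyperplane N (c : 'I_N -> R) b i : c i != 0 ->
  lebesgue_tuple (hyperplane c b) = 0%E.
Proof.
elim: N c b i => [|N IH] c b i ci; first by case: i {ci}.
have sec x : xsection [set xt : borelR * N.-tuple borelR |
    hyperplane c b [tuple of xt.1 :: xt.2]] x =
    hyperplane (fun j => c (lift ord0 j)) (b - c ord0 * x).
  apply/seteqP; split => v; rewrite /xsection /= inE /hyperplane /= big_ord_recl.
    rewrite tnth0 => <-; rewrite addrC addKr; apply: eq_bigr => j _.
    by rewrite tnthS.
  move=> e; rewrite tnth0 -[RHS](subrK (c ord0 * x)) addrC -e; congr (_ + _).
  by apply: eq_bigr => j _; rewrite tnthS.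
case: (pselect (exists j, c (lift ord0 j) != 0)) => [[j cj]|none].
  apply: (integral_point (r := 0)) => x _ /=; rewrite sec; exact: IH cj.
have c0 j : c (lift ord0 j) = 0.
  by apply: contra_notP none => /eqP ?; exists j.
have {}ci : c ord0 != 0.
  by case: (unliftP ord0 i) ci => [j ->|->//]; rewrite c0 eqxx.
apply: (integral_point (r := b / c ord0)) => x xb /=; rewrite sec.
suff -> : hyperplane (fun j => c (lift ord0 j)) (b - c ord0 * x) = set0.
  exact: lebesgue_tuple0.
apply/seteqP; split=> v //; rewrite /hyperplane /= big1 => [e|j _]; last by rewrite c0 mul0r.
move: xb; have -> : b = c ord0 * x by apply/eqP; rewrite -subr_eq0 -e.
by rewrite mulrC mulKf ?eqxx// .
Qed.

Lemma ae_hyperplane N (P : probability (N.-tuple borelR) R) (c : 'I_N -> R) b i :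
  continuous_distribution P -> c i != 0 ->
  {ae P, forall v, \sum_i c i * tnth v i != b}.
Proof.
move=> cP ci; exists (hyperplane c b); split.
- exact: measurable_hyperplane.
- by apply: cP; [exact: measurable_hyperplane|exact: lebesgue_hyperplane ci].
- by move=> v /negP; rewrite negbK => /eqP.
Qed.

Lemma ae_forall_fin N (P : probability (N.-tuple borelR) R) (I : finType)
    (K : I -> N.-tuple borelR -> Prop) :
  (forall i, {ae P, forall v, K i v}) -> {ae P, forall v, forall i, K i v}.
Proof.
move=> h.
have : P.-negligible (\big[setU/set0]_(i : I) (~` [set v | K i v])).
  elim/big_ind: _; [exact: negligible_set0|exact: negligibleU|move=> i _; exact: h].
apply: negligibleS => v /= /existsNP[i nK].
by rewrite -bigcup_seq /=; exists i => //; rewrite /= mem_index_enum.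
Qed.

Variable B : Type.

(** The rows of [T] being nonzero and pairwise distinct, each of T_i and T_i - T_j defines a proper
    hyperplane through the origin, and [v] almost surely avoids their finite union. *)
Lemma as_random N (I : finType) (T : I -> 'I_N -> R)
    (f : N.-tuple R -> prog R B) (Q : B -> Prop) :
  (forall i, exists a, T i a != 0) ->
  (forall i j, i != j -> exists a, T i a != T j a) ->
  (forall v : N.-tuple R, (forall i, \sum_a T i a * tnth v a != 0) ->
     (forall i j, i != j -> \sum_a T i a * tnth v a != \sum_a T j a * tnth v a) ->
     almost_surely (f v) Q) ->
  almost_surely (bind (call (Random N)) f) Q.
Proof.
move=> T0 Tinj h P cP /=.
have h1 : {ae P, forall v, forall i, \sum_a T i a * tnth v a != 0}.
  by apply: ae_forall_fin => i; have [a Ta] := T0 i; exact: ae_hyperplane Ta.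
have h2 : {ae P, forall v, forall ij : I * I, ij.1 != ij.2 ->
    \sum_a T ij.1 a * tnth v a != \sum_a T ij.2 a * tnth v a}.
  apply: ae_forall_fin => -[i j] /=.
  have [->|ij] := eqVneq i j; first by apply: aeW => v.
  have [a Ta] := Tinj _ _ ij.
  have Ta' : T i a - T j a != 0 by rewrite subr_eq0.
  apply: negligibleS (ae_hyperplane (c := fun a => T i a - T j a) 0 cP Ta') => v.
  apply: contra_not => /= + _.
  under eq_bigr do rewrite mulrBl.
  by rewrite sumrB subr_eq0.
apply: negligibleS (negligibleU h1 h2) => v nh.
apply: contra_notP nh => /not_orP[/contrapT k1 /contrapT k2].
by apply: h => // i j ij; exact: (k2 (i, j)).
Qed.

End Hyperplanes.

(** * Linear and quadratic forms *)

Section Substitution.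
Variable R : realType.

Lemma comp_mpolyA n k l (p : {mpoly R[n]}) (lq : n.-tuple {mpoly R[k]})
    (lr : k.-tuple {mpoly R[l]}) :
  (p \mPo lq) \mPo lr = p \mPo [tuple tnth lq i \mPo lr | i < n].
Proof.
rewrite (comp_mpolyEX p lq) (comp_mpolyEX p) raddf_sum /=.
apply: eq_bigr => m _; rewrite comp_mpolyZ; congr (_ *: _).
rewrite !comp_mpolyX rmorph_prod /=; apply: eq_bigr => i _.
by rewrite rmorphXn /= tnth_mktuple.
Qed.

(** Rows of matrices stand for linear combinations, so that substitutions and changes of basis
    become matrix products ([lcomb_mul]). *)
Definition lcomb n m N (T : 'M[R]_(m, N)) (u : 'I_N -> {mpoly R[n]}) i :=
  \sum_a T i a *: u a.

Definition lin m N (T : 'M[R]_(m, N)) i : {mpoly R[N]} := lcomb T (fun a => 'X_a) i.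

Lemma lcomb_mul n m N p (P : 'M[R]_(m, N)) (T : 'M[R]_(N, p)) (u : 'I_p -> {mpoly R[n]}) i :
  lcomb (P *m T) u i = lcomb P (lcomb T u) i.
Proof.
rewrite /lcomb; under [RHS]eq_bigr do rewrite scaler_sumr.
rewrite exchange_big; apply: eq_bigr => a _; rewrite mxE scaler_suml.
by apply: eq_bigr => b _; rewrite scalerA.
Qed.

Lemma lcomb1 n N (u : 'I_N -> {mpoly R[n]}) i : lcomb 1%:M u i = u i.
Proof.
rewrite /lcomb (bigD1 i) //= mxE eqxx scale1r big1 ?addr0 // => j ji.
by rewrite mxE eq_sym (negbTE ji) scale0r.
Qed.

Lemma lin_comp n m N (T : 'M[R]_(m, N)) (u : N.-tuple {mpoly R[n]}) i :
  lin T i \mPo u = lcomb T (tnth u) i.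
Proof.
rewrite raddf_sum /=; apply: eq_bigr => a _.
by rewrite comp_mpolyZ comp_mpolyXU -tnth_nth.
Qed.

Lemma mcoeff_lin m N (T : 'M[R]_(m, N)) i a : (lin T i)@_U_(a) = T i a.
Proof.
rewrite raddf_sum /= (bigD1 a) //= mcoeffZ mcoeffXU eqxx mulr1 big1 ?addr0// => b ba.
by rewrite mcoeffZ mcoeffXU (negbTE ba) mulr0.
Qed.

Lemma lin_inj m N (T T' : 'M[R]_(m, N)) : (forall i, lin T i = lin T' i) -> T = T'.
Proof. by move=> e; apply/matrixP => i a; rewrite -!mcoeff_lin e. Qed.

Lemma mderiv_lin m N (T : 'M[R]_(m, N)) i j : (lin T i)^`M(j) = (T i j)%:MP.
Proof.
rewrite raddf_sum /= (bigD1 j) //= mderivZ mderivX mnm1E eqxx -{1}[U_(j)%MM]add0m addmK mpolyX0.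
rewrite scale1r -mul_mpolyC mulr1 big1 ?addr0// => a aj.
by rewrite mderivZ mderivX mnm1E (negbTE aj) scale0r scaler0.
Qed.

Lemma lin_homog m N (T : 'M[R]_(m, N)) i : lin T i \is 1.-homog.
Proof.
apply: rpred_sum => a _; apply: rpredZ; rewrite dhomogX; apply/eqP; exact: mdeg1.
Qed.

(** A right inverse of [T] provides the linear forms whose substitution undoes that of [lin T]. *)
Lemma comp_lin_inj m N (T : 'M[R]_(m, N)) (h : {mpoly R[m]}) :
  row_free T -> h \mPo [tuple lin T i | i < m] = 0 -> h = 0.
Proof.
move=> /row_freeP[K TK] h0.
have := comp_mpolyA h [tuple lin T i | i < m] [tuple lin K a | a < N].
rewrite h0 comp_mpoly0 => /esym.
rewrite (_ : [tuple _ | i < m] = [tuple 'X_i | i < m]) ?comp_mpoly_id//.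
apply: eq_from_tnth => i; rewrite !tnth_mktuple lin_comp.
rewrite (_ : lcomb _ _ _ = lcomb T (lin K) i).
  by rewrite -lcomb_mul TK lcomb1.
by apply: eq_bigr => a _; rewrite tnth_mktuple.
Qed.

Definition qform n N (S : 'M[R]_N) (u : 'I_N -> {mpoly R[n]}) : {mpoly R[n]} :=
  \sum_a \sum_b S a b *: (u a * u b).

Lemma qform_comp n N (S : 'M[R]_N) (u : N.-tuple {mpoly R[n]}) :
  qform S (fun a => 'X_a) \mPo u = qform S (tnth u).
Proof.
rewrite raddf_sum /=; apply: eq_bigr => a _; rewrite raddf_sum /=.
apply: eq_bigr => b _.
by rewrite comp_mpolyZ rmorphM /= !comp_mpolyXU -!tnth_nth.
Qed.

Lemma qform_homog N (S : 'M[R]_N) : qform S (fun a => 'X_a) \is 2.-homog.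
Proof.
apply: rpred_sum => a _; apply: rpred_sum => b _; apply: rpredZ.
have e2 : mdeg (U_(a) + U_(b)) = 2%N by rewrite mdegD !mdeg1.
by rewrite -mpolyXD dhomogX; apply/eqP; exact: e2.
Qed.

(** Polarisation: the value at e_i + e_j is S_ii + 2 S_ij + S_jj, and i = j, that is the point 2
    e_i, gives the diagonal first. *)
Lemma qform_inj N (S S' : 'M[R]_N) : S^T = S -> S'^T = S' ->
  qform S (fun a => 'X_a) = qform S' (fun a => 'X_a) -> S = S'.
Proof.
move=> sS sS' e.
have E x : \sum_a \sum_b S a b * (x a * x b) = \sum_a \sum_b S' a b * (x a * x b).
  have Ex (M : 'M[R]_N) : (qform M (fun a => 'X_a)).@[x] = \sum_a \sum_b M a b * (x a * x b).
    rewrite raddf_sum /=; apply: eq_bigr => a _; rewrite raddf_sum /=.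
    by apply: eq_bigr => b _; rewrite mevalZ mevalM !mevalXU.
  by rewrite -!Ex e.
pose x (i j a : 'I_N) : R := (a == i)%:R + (a == j)%:R.
have F (M : 'M[R]_N) i j : \sum_a \sum_b M a b * (x i j a * x i j b) =
    M i i + M i j + (M j i + M j j).
  have s (f : 'I_N -> R) k l : \sum_a f a * x k l a = f k + f l.
    rewrite /x; under eq_bigr do rewrite mulrDr.
    have one k' : \sum_a f a * (a == k')%:R = f k'.
      rewrite (bigD1 k') //= eqxx mulr1 big1 ?addr0 // => a ak.
      by rewrite (negbTE ak) mulr0.
    by rewrite big_split /= !one.
  transitivity (\sum_a (M a i + M a j) * x i j a); last by rewrite s.
  apply: eq_bigr => a _; rewrite -(s (M a)) mulr_suml; apply: eq_bigr => b _.
  by rewrite -mulrA [x i j a * _]mulrC.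
have sym (M : 'M[R]_N) i j : M^T = M -> M j i = M i j by move=> sM; rewrite -[in LHS]sM mxE.
have D i : S i i = S' i i.
  have := E (x i i); rewrite !F; lra.
apply/matrixP => i j; have := E (x i j).
rewrite !F !D (sym S i j sS) (sym S' i j sS'); lra.
Qed.

(** The passage from weighted sums of squares to congruence of matrices, through which all
    decompositions are compared. *)
Lemma sum_sqr_lcomb n m N (lam : 'I_m -> R) (T : 'M[R]_(m, N)) (u : 'I_N -> {mpoly R[n]}) :
  \sum_i lam i *: lcomb T u i ^+ 2 =
  qform (T^T *m diag_mx (\row_i lam i) *m T) u.
Proof.
have E a b : (T^T *m diag_mx (\row_i lam i) *m T) a b = \sum_i lam i * (T i a * T i b).
  rewrite mxE; apply: eq_bigr => i _; rewrite mxE (bigD1 i) //= big1 => [|j ji].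
    by rewrite !mxE eqxx mulr1n addr0 [RHS]mulrA [lam i * _]mulrC.
  by rewrite !mxE (negbTE ji) mulr0n mulr0.
rewrite /qform; under [RHS]eq_bigr => a _.
  under eq_bigr do rewrite E scaler_suml.
  rewrite exchange_big; over.
rewrite exchange_big; apply: eq_bigr => i _.
rewrite expr2 /lcomb mulr_suml scaler_sumr; apply: eq_bigr => a _.
rewrite mulr_sumr scaler_sumr; apply: eq_bigr => b _.
by rewrite -scalerAl -scalerAr !scalerA mulrA.
Qed.

Lemma sym_congr m N (D : 'rV[R]_m) (T : 'M[R]_(m, N)) :
  (T^T *m diag_mx D *m T)^T = T^T *m diag_mx D *m T.
Proof. by rewrite !trmx_mul trmxK tr_diag_mx mulmxA. Qed.

Lemma mderiv_lin2 m N (T : 'M[R]_(m, N)) i j :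
  (lin T i ^+ 2)^`M(j) = (2%:R * T i j) *: lin T i.
Proof.
rewrite expr2 mderivM mderiv_lin mulrC -mulrDr -mpolyCD mulrC mul_mpolyC.
by rewrite mulr_natl mulr2n.
Qed.

Lemma mderiv_lin3 m N (T : 'M[R]_(m, N)) i j :
  (lin T i ^+ 3)^`M(j) = (3%:R * T i j) *: lin T i ^+ 2.
Proof.
rewrite exprS mderivM mderiv_lin mderiv_lin2 -scalerAr -expr2 mul_mpolyC.
by rewrite -scalerDl; congr (_ *: _); rewrite !mulr_natl -mulrS.
Qed.

(** ['I_(nmon N 1)] and ['I_N] are different types indexing the same variables; this matrix converts
    coefficient vectors of linear forms into rows indexed by variables. *)
Definition var1mx N : 'M[R]_(nmon N 1, N) := \matrix_(b, a) (var1 b == a)%:R.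

Lemma mon1 N (b : 'I_(nmon N 1)) : mon b = U_(var1 b)%MM.
Proof.
rewrite /mon /var1; case/tupleP: (vars b) => x t; rewrite tuple0 theadE.
by apply/mnmP => i; rewrite mnmE mnm1E /= addn0.
Qed.

Lemma var1_inj N : injective (@var1 N).
Proof. by move=> b b' e; apply: (@mon_inj N 1); rewrite !mon1 e. Qed.

Lemma var1mx_mul_tr N : var1mx N *m (var1mx N)^T = 1%:M.
Proof.
apply/matrixP => b b'; rewrite !mxE (bigD1 (var1 b)) //= !mxE eqxx mul1r big1 => [|a ab].
  by rewrite addr0 eq_sym (inj_eq (@var1_inj N)).
by rewrite !mxE eq_sym (negbTE ab) mul0r.
Qed.

Lemma vform1 N m (W : 'M[R]_(nmon N 1, m)) i :
  vform_mpoly (col i W) = lin (W^T *m var1mx N) i.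
Proof.
rewrite /lin lcomb_mul; apply: eq_bigr => b _; rewrite !mxE mon1; congr (_ *: _).
rewrite /lcomb (bigD1 (var1 b)) //= mxE eqxx scale1r big1 ?addr0// => a ab.
by rewrite mxE eq_sym (negbTE ab) scale0r.
Qed.

Lemma row_free_var1mx N : row_free (var1mx N).
Proof. by apply/row_freeP; exists (var1mx N)^T; exact: var1mx_mul_tr. Qed.

Lemma forms1 N m (W : 'M[R]_(nmon N 1, m)) :
  forms W = [tuple lin (W^T *m var1mx N) i | i < m].
Proof. by apply: eq_from_tnth => i; rewrite !tnth_mktuple vform1. Qed.

Lemma comp_forms1_inj N m (W : 'M[R]_(nmon N 1, m)) (h : {mpoly R[m]}) :
  row_free W^T -> h \mPo forms W = 0 -> h = 0.
Proof.
move=> fW; rewrite forms1; apply: comp_lin_inj.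
by rewrite /row_free mxrankMfree // row_free_var1mx.
Qed.

End Substitution.

(* Unlike [simpl], does not unfold the programs under [bind]. *)
Ltac reduce_prog := lazy beta zeta iota delta [projT1 projT2 fst snd succeed].

(** * Decomposition into powers of linear forms *)

Section DecomposeLinear.
Variable R : realType.

(** Entrywise, (d_i - mu_j) Z_ij = 0. As the d_i are distinct, each column of the invertible matrix
    Z has exactly one nonzero entry, so Z is a permutation matrix up to scaling. *)
Lemma eig_monomial m (d mu : 'rV[R]_m) (Z : 'M[R]_m) :
  (forall i j, i != j -> d 0 i != d 0 j) -> Z \in unitmx ->
  diag_mx d *m Z = Z *m diag_mx mu ->
  exists s : 'I_m -> 'I_m, injective s /\ forall j,
    [/\ mu 0 j = d 0 (s j), Z (s j) j != 0 & forall i, i != s j -> Z i j = 0].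
Proof.
move=> dinj uZ e.
have eij i j : d 0 i * Z i j = Z i j * mu 0 j.
  move/matrixP: e => /(_ i j); rewrite mul_diag_mx mul_mx_diag !mxE //.
have nz j : exists i, Z i j != 0.
  apply: contrapT => none.
  have c0 : Z *m delta_mx j (0 : 'I_1) = 0.
    rewrite -colE; apply/colP => i; rewrite !mxE; apply/eqP.
    by apply: contra_notT none => ?; exists i.
  have := mulKmx uZ (delta_mx j (0 : 'I_1)); rewrite c0 mulmx0 => /matrixP/(_ j 0).
  by rewrite !mxE !eqxx => /esym/eqP; rewrite oner_eq0.
have [s sP] := choice nz.
have muE j : mu 0 j = d 0 (s j).
  by apply/esym/(mulfI (sP j)); rewrite -eij mulrC.
have off j i : i != s j -> Z i j = 0.
  move=> ne; apply: contraTeq (dinj _ _ ne) => nzi; rewrite negbK -muE.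
  by apply/eqP/(mulfI nzi); rewrite -eij mulrC.
exists s; split; last by move=> j; split => //; exact: off.
move=> j j' ss; apply/eqP; apply: contraT => jj'.
(* Column [l] of Z is supported in row [s l], so the sum in entry (k, l) of [invmx Z *m Z] has a
   single term. If s j = s j' with j different from j', the same entry of the inverse would be both
   zero and nonzero. *)
have inv k l : (invmx Z) k (s l) * Z (s l) l = (k == l)%:R.
  have /matrixP/(_ k l) := mulVmx uZ; rewrite [RHS]mxE => <-.
  rewrite mxE (bigD1 (s l)) //= big1 ?addr0// => i ne; by rewrite off ?mulr0.
have := inv j j'; rewrite (negbTE jj') -ss => /eqP.
rewrite mulf_eq0 -[X in _ || X]/(Z (s j) j' == 0) ss (negbTE (sP j')) orbF => /eqP i0.
by have := inv j j; rewrite ss i0 mul0r eqxx => /esym/eqP; rewrite oner_eq0.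
Qed.

Lemma lin_tuple m N (T : 'M[R]_(m, N)) : tnth [tuple lin T i | i < m] = lin T.
Proof. by apply/funext => i; rewrite tnth_mktuple. Qed.

(** The rows of [T] are the sought linear forms, and T = P Tw expresses them in the basis w that the
    run happens to use. With Λ = diag(lam) and d = T v one gets M = P^T Λ P and Mv = P^T Λ diag(d)
    P, so the generalized eigenproblem turns into diag(d) Z = Z diag(mu) for Z = P X. *)
Lemma decompose_linearP m N (T : 'M[R]_(m, N)) (lam : 'I_m -> R)
    (g2 : 'cV[R]_(nmon N 2)) (g3 : 'cV[R]_(nmon N 3)) :
  row_free T -> (forall i, lam i != 0) ->
  vform_mpoly g2 = \sum_i lam i *: lin T i ^+ 2 ->
  vform_mpoly g3 = \sum_i lam i *: lin T i ^+ 3 ->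
  almost_surely (decompose_linear g2 g3)
    (fun r => exists s : 'I_(projT1 r) -> 'I_m, bijective s /\
       forall j, vform_mpoly (col j (projT2 r).1) = lin T (s j) /\
                 (projT2 r).2 j 0 = lam (s j)).
Proof.
move=> fT lam0 eg2 eg3; rewrite /decompose_linear.
apply: as_bind (partialsP g2) _ => J2 J2E.
apply: as_image => r W fW eW; reduce_prog.
have [K TK] := row_freeP fT.
set Tw := W^T *m var1mx R N.
have fTw : row_free Tw by rewrite /row_free mxrankMfree ?row_free_var1mx.
(* The gradient of g2 is T^T (2 Λ) T; since T^T (2 Λ) has full column rank, the directional
   derivatives span the row space of T, and the rank [r] found by the run is [m]. *)
have J2T : J2^T *m var1mx R N = T^T *m diag_mx (\row_i (2%:R * lam i)) *m T.
  apply: lin_inj => j; rewrite -vform1 J2E eg2 raddf_sum /= /lin lcomb_mul.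
  rewrite {1}/lcomb; apply: eq_bigr => i _.
  rewrite mderivZ mderiv_lin2 scalerA; congr (_ *: _).
  rewrite mxE (bigD1 i) //= big1 ?addr0 => [|k ki]; first by rewrite !mxE eqxx mulr1n; ring.
  by rewrite !mxE (negbTE ki) mulr0n mulr0.
set D2 := diag_mx _ in J2T.
have uD2 : D2 \in unitmx.
  rewrite unitmxE det_diag unitfE.
  by apply/prodf_neq0 => i _; rewrite mxE mulf_neq0 ?pnatr_eq0.
have TwT : (Tw == T)%MS.
  have e1 : (Tw == J2^T *m var1mx R N)%MS.
    by move: eW => /andP[e1 e2]; apply/andP; split; exact: submxMr.
  apply/eqmxP; apply: eqmx_trans (eqmxP e1) _; rewrite J2T; apply: eqmxMfull.
  by rewrite /row_full mxrankMfree ?row_free_unit // mxrank_tr; exact: fT.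
have rm : r = m.
  by rewrite -(eqP fTw) -[RHS](eqP fT); move/eqmxP: TwT => ->.
subst r.
have /submxP[P TP] : (T <= Tw)%MS by case/andP: TwT.
have uP : P \in unitmx.
  rewrite -row_free_unit /row_free eqn_leq rank_leq_row /=.
  by rewrite -{1}(eqP fT) TP mxrankM_maxl.
have linT i : lin T i = lcomb P (lin Tw) i by rewrite TP /lin lcomb_mul.
apply: (as_random (T := fun i a => T i a)).
- move=> i; apply: contrapT => none.
  have /row_freeP[K' TK'] := fT.
  have /matrixP/(_ i i) := TK'; rewrite !mxE eqxx big1 => [/eqP|a _].
    by rewrite eq_sym oner_eq0.
  suff -> : T i a = 0 by rewrite mul0r.
  by apply/eqP; apply: contra_notT none => ?; exists a.
(* Equal rows i and j of T would make the rows i and j of [T *m K], the identity matrix, equal. *)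
- move=> i j ij; apply: contrapT => none.
  have h : (T *m K) i i = 1 by rewrite TK mxE eqxx.
  have h' : (T *m K) j i = 0 by rewrite TK mxE eq_sym (negbTE ij).
  suff : (1 : R) = 0 by apply/eqP; rewrite oner_eq0.
  rewrite -h -h' !mxE; apply: eq_bigr => a _; congr (_ * _).
  by apply/eqP; apply: contra_notT none => ?; exists a.
move=> v v0 vinj.
set d := \row_i \sum_a T i a * tnth v a.
set LM := diag_mx (\row_i lam i).
apply: as_bind.
  apply: (@expressP _ _ 1 _ W 2 g2 (\sum_i lam i *: lin P i ^+ 2)).
  - apply: rpred_sum => i _; apply: rpredZ; exact: dhomogMn (lin_homog P i).
  - apply: etrans (esym eg2).
    rewrite raddf_sum; apply: eq_bigr => i _ /=.
    by rewrite comp_mpolyZ rmorphXn /= lin_comp forms1 lin_tuple linT.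
  - by move=> h _; exact: comp_forms1_inj.
move=> c2 ec2.
apply: as_bind (sym_matrixP c2) _ => M [sM eM].
have {sM eM ec2} ME : M = P^T *m LM *m P.
  apply: qform_inj => //; first exact: sym_congr.
  by rewrite -sum_sqr_lcomb -ec2 eM.
apply: as_bind (partialsP g3) _ => J3 J3E.
apply: as_mul; apply: as_const; apply: as_mul.
set h3 := _ *m _ *m _.
have eh3 : vform_mpoly h3 = \sum_i (lam i * d 0 i) *: lin T i ^+ 2.
  have -> : h3 = 3%:R^-1 *: (J3 *m \col_j tnth v j).
    rewrite /h3; have -> : map_mx ratr ((3%:R^-1 : rat)%:M) = (3%:R^-1)%:M :> 'M[R]_1.
      by rewrite map_scalar_mx fmorphV rmorph_nat.
    by apply/colP => b; rewrite !mxE big_ord1 !mxE eqxx mulr1n mulrC.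
  rewrite linearZ /= vform_mulmx.
  rewrite (eq_bigr (fun j => \sum_i (tnth v j * (lam i * (3%:R * T i j))) *: lin T i ^+ 2)).
    rewrite exchange_big scaler_sumr; apply: eq_bigr => i _ /=.
    rewrite -scaler_suml scalerA; congr (_ *: _); rewrite mxE !mulr_sumr.
    by apply: eq_bigr => j _; field.
  move=> j _; rewrite J3E eg3 [_^`M(j)]raddf_sum /= mxE scaler_sumr; apply: eq_bigr => i _.
  by rewrite mderivZ mderiv_lin3 !scalerA -mulrA.
apply: as_bind.
  apply: (@expressP _ _ 1 _ W 2 h3 (\sum_i (lam i * d 0 i) *: lin P i ^+ 2)).
  - apply: rpred_sum => i _; apply: rpredZ; exact: dhomogMn (lin_homog P i).
  - apply: etrans (esym eh3).
    rewrite raddf_sum; apply: eq_bigr => i _ /=.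
    by rewrite comp_mpolyZ rmorphXn /= lin_comp forms1 lin_tuple linT.
  - by move=> h _; exact: comp_forms1_inj.
move=> c3 ec3.
apply: as_bind (sym_matrixP c3) _ => Mv [sMv eMv].
have {sMv eMv ec3 eh3} MvE : Mv = P^T *m LM *m diag_mx d *m P.
  have -> : P^T *m LM *m diag_mx d *m P =
      P^T *m diag_mx (\row_i (lam i * d 0 i)) *m P.
    congr (_ *m P); rewrite -mulmxA; congr (_ *m _).
    by rewrite mulmx_diag; congr diag_mx; apply/rowP => i; rewrite !mxE.
  apply: qform_inj => //; first exact: sym_congr.
  by rewrite -sum_sqr_lcomb -ec3 eMv.
have uPL : P^T *m LM \in unitmx.
  rewrite unitmx_mul unitmx_tr uP unitmxE det_diag unitfE.
  by apply/prodf_neq0 => i _; rewrite mxE.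
apply: as_eig.
  (* For X = P^-1 both sides are P^T Λ diag(d). *)
  exists d, (invmx P); rewrite unitmx_inv; split => //.
  by rewrite ME MvE -!mulmxA mulmxV // mulKVmx // mulmx1.
move=> mu X uX eX; reduce_prog.
set Z := P *m X.
have uZ : Z \in unitmx by rewrite unitmx_mul uP.
have eZ : diag_mx d *m Z = Z *m diag_mx mu.
  apply: (can_inj (mulKmx uPL)); rewrite -[LHS]mulmxA.
  by move: eX; rewrite ME MvE -!mulmxA.
have dinj i j : i != j -> d 0 i != d 0 j by move=> ij; rewrite !mxE; exact: vinj.
have [s [sinj sP]] := eig_monomial dinj uZ eZ.
have MX : M *m X = P^T *m LM *m Z by rewrite ME -!mulmxA.
apply: as_mul; apply: as_mul; apply: as_mul; reduce_prog.
set bwv := _ *m (M *m X).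
(* b_j is row [s j] of P scaled by lam * Z. Its value at v carries the same factor times d_(s j) =
   mu_j, so mu_j / (b_j^T w(v)) is the inverse of the factor and a_j is row [s j] of P itself,
   however x_j was scaled. *)
have MXE a j : (M *m X) a j = lam (s j) * Z (s j) j * P (s j) a.
  rewrite MX -mulmxA mxE (bigD1 (s j)) //= big1 => [|i ij].
    by rewrite mul_diag_mx !mxE addr0 mulrC.
  by rewrite mul_diag_mx !mxE; have [_ _ /(_ i ij)] := sP j; rewrite !mxE => ->; rewrite !mulr0.
have bwvE j : bwv 0 j = lam (s j) * Z (s j) j * d 0 (s j).
  rewrite /bwv.
  have -> : (\row_i tnth v (var1 i)) *m W = (\row_a tnth v a) *m Tw^T.
    rewrite trmx_mul trmxK mulmxA; congr (_ *m W); apply/rowP => b.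
    rewrite !mxE (bigD1 (var1 b)) //= !mxE eqxx mulr1 big1 ?addr0// => a ab.
    by rewrite !mxE eq_sym (negbTE ab) mulr0.
  rewrite mxE; under eq_bigr do rewrite MXE mulrCA.
  rewrite -mulr_sumr; congr (_ * _).
  rewrite [RHS]mxE TP; under eq_bigr do rewrite mxE mulr_suml.
  rewrite exchange_big; under [RHS]eq_bigr do rewrite mxE mulr_suml.
  rewrite [RHS]exchange_big exchange_big; apply: eq_bigr => b _; apply: eq_bigr => a _.
  by rewrite !mxE; ring.
clearbody bwv.
have lz j : lam (s j) * Z (s j) j != 0 by have [_ z _] := sP j; rewrite mulf_neq0.
have d0 i : d 0 i != 0 by rewrite mxE v0.
apply: as_bind.
  apply: (as_columns (Q := fun j x => forall a, x a 0 = P (s j) a)) => j.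
  apply: as_solve.
    exists (const_mx (mu 0 j / bwv 0 j)); apply/colP => i; rewrite mxE big_ord1 !mxE.
    by rewrite mulrC divfK // bwvE mulf_neq0.
  move=> x /colP/(_ 0); rewrite mxE big_ord1 !mxE => xE.
  reduce_prog; apply: as_call_mul => a.
  rewrite mxE big_ord1 mxE MXE mulrAC.
  have [mj _ _] := sP j.
  have -> : lam (s j) * Z (s j) j * x 0 0 = 1; last by rewrite mul1r.
  apply: (mulIf (d0 (s j))); rewrite mul1r -[RHS]mj -xE bwvE; ring.
move=> A AE; apply: as_mul.
set L := W *m A.
have LE j : vform_mpoly (col j L) = lin T (s j).
  rewrite vform1 linT /L trmx_mul -mulmxA -/Tw /lin lcomb_mul.
  by apply: eq_bigr => a _; rewrite mxE -(AE j a) mxE.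
apply: as_bind.
  apply: (as_columns (Q := fun j x => vform_mpoly x = lin T (s j) ^+ 2)) => j.
  by apply: as_mono (form_mulP _ _) => x ->; rewrite LE expr2.
move=> S SE.
have SyE (y : 'cV[R]_m) : vform_mpoly (S *m y) = \sum_j y j 0 *: lin T (s j) ^+ 2.
  by rewrite vform_mulmx; apply: eq_bigr => j _; rewrite SE.
have bs : bijective s by exact: injF_bij.
have [t st ts] := bs.
apply: as_solve.
  exists (\col_j lam (s j)); apply: vform_mpoly_inj; rewrite [LHS]SyE.
  rewrite [RHS]eg2 [RHS](reindex s) /=; last by exists t => ? _; rewrite ?st ?ts.
  by apply: eq_bigr => j _; rewrite mxE.
move=> y Sy /=; exists s; split => // j; split; first exact: LE.
have : \sum_j y j 0 *: lin T (s j) ^+ 2 = \sum_i lam i *: lin T i ^+ 2.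
  by rewrite -SyE [RHS](_ : _ = vform_mpoly g2)// Sy.
rewrite (reindex t) /=; last by exists s => ? _; rewrite ?st ?ts.
under eq_bigr do rewrite ts.
rewrite !sum_sqr_lcomb => e.
have : T^T *m diag_mx (\row_i y (t i) 0) *m T = T^T *m diag_mx (\row_i lam i) *m T.
  by apply: qform_inj => //; exact: sym_congr.
(* Congruence by T is undone by its right inverse K, so the system for the weights has only one
   solution. *)
move/(congr1 (fun Y => K^T *m Y *m K)).
have KT Y : K^T *m (T^T *m Y *m T) *m K = Y.
  by rewrite !mulmxA -trmx_mul TK trmx1 mul1mx -mulmxA TK mulmx1.
rewrite !KT => /matrixP/(_ (s j) (s j)); rewrite !mxE eqxx !mulr1n st //.
Qed.

End DecomposeLinear.

(** * Independence of products *)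

Section Products.
Variable R : realType.

Lemma nmonS N d : nmon N.+1 d = 'C(d + N, d).
Proof. by rewrite -(size_basis N d) size_map -cardE. Qed.

(** The origin of the binomial coefficient in the dimension hypothesis: the number of cubic
    monomials in N variables. *)
Lemma nmon3 N : (0 < N)%N -> nmon N 3 = 'C(N + 2, 3).
Proof. by case: N => // N _; rewrite nmonS addSn -addnS addnC. Qed.

Lemma prod_homog n k (I : eqType) (t : seq I) (u : I -> {mpoly R[n]}) :
  (forall i, u i \is k.-homog) -> \prod_(x <- t) u x \is (size t * k).-homog.
Proof.
move=> hu; elim: t => [|x t IH]; first by rewrite big_nil mul0n; exact: dhomog1.
by rewrite big_cons mulSn; exact: dhomogM.
Qed.

Lemma comp_homog n N d k (u : N.-tuple {mpoly R[n]}) (h : {mpoly R[N]}) :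
  h \is d.-homog -> (forall i, tnth u i \is k.-homog) -> h \mPo u \is (d * k).-homog.
Proof.
move=> /homog_vform[c <-] hu; rewrite comp_vform_tuple.
apply: rpred_sum => i _; apply: rpredZ.
by have := prod_homog (vars i) hu; rewrite size_tuple.
Qed.

Definition formtuple n k N (q : 'I_N -> dhomog n R k) : N.-tuple {mpoly R[n]} :=
  [tuple (q i : {mpoly R[n]}) | i < N].

Lemma lcomb_val n k N m (a : 'M[R]_(m, N)) (q : 'I_N -> dhomog n R k) i :
  lcomb a (tnth (formtuple q)) i = (\sum_j a i j *: q j : dhomog n R k).
Proof. by rewrite raddf_sum /=; apply: eq_bigr => j _; rewrite tnth_mktuple. Qed.

(* The C(N+2,3) products of triples of the [q i] span a space of dimension
   C(N+2,3), hence are linearly independent. *)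
Lemma triple_products_inj n k (U : {vspace dhomog n.+1 R k}) N (q : 'I_N -> dhomog n.+1 R k) :
  (0 < N)%N -> \dim (linspan (triple_products U)) = 'C(N + 2, 3) ->
  (forall p, p \in U -> exists a : 'rV_N, p = \sum_i a 0 i *: q i) ->
  forall h, h \is 3.-homog -> h \mPo formtuple q = 0 -> h = 0.
Proof.
move=> N0 dimU Uq h hh h0.
have hq i : tnth (formtuple q) i \is k.-homog by rewrite tnth_mktuple dhomog_is_dhomog.
have Xh (i : 'I_(nmon N 3)) : \prod_(x <- vars i) tnth (formtuple q) x \is (3 * k).-homog.
  by have := prod_homog (vars i) hq; rewrite size_tuple.
pose Y i := DHomog (Xh i).
pose X := [tuple Y i | i < nmon N 3].
have XY (i : 'I_(nmon N 3)) : X`_i = Y i by rewrite -tnth_nth tnth_mktuple.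
have compX c : vform_mpoly c \mPo formtuple q =
    (\sum_i c i 0 *: Y i : dhomog n.+1 R (3 * k)).
  by rewrite comp_vform_tuple raddf_sum.
have sub : (linspan (triple_products U) <= <<X>>)%VS.
  apply: (linspan_smallest _).2 => p [u [v [w [/Uq[a ->] /Uq[b ->] /Uq[c ->] ep]]]].
  pose g := lin a 0 * lin b 0 * lin c 0.
  have gh : g \is 3.-homog.
    by rewrite !(dhomogM (d := 2) (e := 1), dhomogM (d := 1) (e := 1)) ?lin_homog.
  have [e eg] := homog_vform gh.
  have -> : p = \sum_i e i 0 *: Y i.
    apply: val_inj; rewrite /= -compX eg ep !rmorphM /= !lin_comp.
    by rewrite !lcomb_val.
  by apply: memv_suml => i _; rewrite -XY; apply/memvZ/memv_span/mem_nth; rewrite size_tuple.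
have fX : free X.
  rewrite /free eqn_leq dim_span size_tuple /=.
  by apply: leq_trans (dimvS sub); rewrite dimU (nmon3 N0).
have [c ec] := homog_vform hh.
move: h0; rewrite -ec compX => /(@val_inj _ _ _ _ 0) X0.
have c0 : forall i, c i 0 = 0.
  move/freeP: fX => /(_ (fun i => c i 0)); apply.
  by rewrite -[RHS]X0; apply: eq_bigr => i _; rewrite XY.
rewrite (_ : c = 0) ?raddf0//; apply/colP => i; by rewrite c0 mxE.
Qed.

(** If [h] is killed by the substitution, so is its product with a variable, in degree d + 1; and
    the polynomial ring is a domain. *)
Lemma comp_inj_lower n N (u : N.-tuple {mpoly R[n]}) d :
  (0 < N)%N ->
  (forall h : {mpoly R[N]}, h \is d.+1.-homog -> h \mPo u = 0 -> h = 0) ->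
  forall h : {mpoly R[N]}, h \is d.-homog -> h \mPo u = 0 -> h = 0.
Proof.
move=> N0 inj h hh h0.
have X1 : ('X_(Ordinal N0) : {mpoly R[N]}) \is 1.-homog.
  by rewrite dhomogX; apply/eqP; exact: mdeg1.
have : h * 'X_(Ordinal N0) = 0.
  apply: inj; last by rewrite rmorphM /= h0 mul0r.
  by rewrite -addn1; exact: dhomogM.
move/eqP; rewrite mulf_eq0 => /orP[/eqP//|/eqP/(congr1 (mcoeff U_(Ordinal N0)))].
by rewrite mcoeffXU eqxx mcoeff0 => /eqP; rewrite oner_eq0.
Qed.

(** Independence of products does not depend on the basis: substituting [w] amounts to substituting
    the rows of [T], which is injective, and then [u]. *)
Lemma comp_inj_unit n N (u w : N.-tuple {mpoly R[n]}) (T : 'M[R]_N) d :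
  row_free T -> (forall i, tnth w i = lcomb T (tnth u) i) ->
  (forall h : {mpoly R[N]}, h \is d.-homog -> h \mPo u = 0 -> h = 0) ->
  forall h : {mpoly R[N]}, h \is d.-homog -> h \mPo w = 0 -> h = 0.
Proof.
move=> fT wE inj h hh h0; apply: (comp_lin_inj fT); apply: inj.
  rewrite -[X in X.-homog]muln1; apply: comp_homog => // i.
  by rewrite tnth_mktuple lin_homog.
rewrite comp_mpolyA -[RHS]h0; congr comp_mpoly; apply: eq_from_tnth => i.
by rewrite !tnth_mktuple lin_comp wE.
Qed.

Lemma qform_congr n N m (S : 'M[R]_m) (T : 'M[R]_(m, N)) (u : 'I_N -> {mpoly R[n]}) :
  qform (T^T *m S *m T) u = qform S (lcomb T u).
Proof.
have EE a b : (T^T *m S *m T) a b = \sum_i \sum_j S i j * (T i a * T j b).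
  rewrite mxE; under eq_bigr do rewrite mxE mulr_suml.
  rewrite exchange_big; apply: eq_bigr => i _; apply: eq_bigr => j _.
  by rewrite mxE; ring.
rewrite /qform; under eq_bigr => a _.
  under eq_bigr do rewrite EE scaler_suml.
  rewrite exchange_big; over.
rewrite exchange_big; apply: eq_bigr => i _.
under eq_bigr => a _.
  under eq_bigr do rewrite scaler_suml.
  rewrite exchange_big; over.
rewrite exchange_big; apply: eq_bigr => j _ /=.
rewrite /lcomb mulr_suml scaler_sumr; apply: eq_bigr => a _.
rewrite mulr_sumr scaler_sumr; apply: eq_bigr => b _.
by rewrite -scalerAl -scalerAr !scalerA mulrA.
Qed.

(** Independent pairwise products leave a form only one symmetric Gram matrix with respect to
    [u]. *)
Lemma qform_comp_inj n N (u : N.-tuple {mpoly R[n]}) (S S' : 'M[R]_N) :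
  (forall h : {mpoly R[N]}, h \is 2.-homog -> h \mPo u = 0 -> h = 0) ->
  S^T = S -> S'^T = S' -> qform S (tnth u) = qform S' (tnth u) -> S = S'.
Proof.
move=> inj sS sS' e; apply: qform_inj => //; apply/eqP; rewrite -subr_eq0; apply/eqP.
apply: inj; first by rewrite rpredB ?qform_homog.
by rewrite raddfB /= !qform_comp e subrr.
Qed.

End Products.

(** * Positive semidefinite matrices *)

Section PSD.
Variable R : realType.

Definition qf d (G : 'M[R]_d) (x : 'cV[R]_d) := (x^T *m G *m x) 0 0.

Lemma qf_add d (G : 'M[R]_d) (x e : 'cV[R]_d) c : G^T = G ->
  qf G (x + c *: e) = qf G x + 2%:R * c * (e^T *m G *m x) 0 0 + c ^+ 2 * qf G e.
Proof.
move=> sG; have eT : (x + c *: e)^T = x^T + c *: e^T by apply/matrixP => i j; rewrite !mxE.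
rewrite /qf eT !mulmxDl !mulmxDr -!scalemxAl -!scalemxAr.
have -> : x^T *m G *m e = (e^T *m G *m x)^T by rewrite !trmx_mul trmxK sG mulmxA.
have F (A B C D : 'M[R]_1) : (A + c *: B^T + (c *: C + c *: (c *: D))) 0 0 =
    A 0 0 + c * B 0 0 + (c * C 0 0 + c * (c * D 0 0)) by rewrite !mxE.
by rewrite F; ring.
Qed.

Lemma qf_delta d (G : 'M[R]_d) i j :
  ((delta_mx i (0 : 'I_1))^T *m G *m delta_mx j (0 : 'I_1)) 0 0 = G i j.
Proof. by rewrite trmx_delta -rowE -colE !mxE. Qed.

Lemma psd_row0 d (G : 'M[R]_d) i j : psd G -> G i i = 0 -> G i j = 0.
Proof.
move=> [sG pG] Gii; apply/eqP/contraT => nz.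
(* At e_j + c e_i the form takes the value G_jj + 2 c G_ij, and this c makes it -1. *)
have := pG (delta_mx j 0 + (- (G j j + 1) / (2%:R * G i j)) *: delta_mx i 0).
rewrite -/(qf _ _) (qf_add _ _ _ sG) /qf !qf_delta Gii.
have -> : 2 * (- (G j j + 1) / (2 * G i j)) * G i j = - (G j j + 1) by field.
by lra.
Qed.

(** A Schur complement step: the value of the new matrix at x is the minimum over c of the value of
    G at x + c e_i, attained at c = - (G x)_i / G_ii. *)
Lemma psd_deflate d (G : 'M[R]_d) i : psd G -> 0 < G i i ->
  psd (G - (G i i)^-1 *: (col i G *m (col i G)^T)).
Proof.
move=> [sG pG] a0; split.
  by rewrite linearB linearZ /= trmx_mul trmxK sG.
move=> x; set a := G i i in a0 *; pose e : 'cV[R]_d := delta_mx i 0.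
set s := (e^T *m G *m x) 0 0.
have := pG (x + (- (s / a)) *: e); rewrite -/(qf _ _) (qf_add _ _ _ sG) -/s.
have -> : qf G e = a by rewrite /qf qf_delta.
have gx : (col i G)^T *m x = s%:M.
  rewrite [LHS]mx11_scalar; congr (_%:M).
  by rewrite colE trmx_mul sG.
have -> : (x^T *m (G - a^-1 *: (col i G *m (col i G)^T)) *m x) 0 0 =
    qf G x - a^-1 * s ^+ 2.
  have e2 : x^T *m (col i G *m (col i G)^T) *m x = (x^T *m col i G) *m ((col i G)^T *m x).
    by rewrite !mulmxA.
  rewrite mulmxBr mulmxBl -scalemxAr -scalemxAl e2 gx.
  have -> : x^T *m col i G = s%:M by rewrite -[LHS]trmxK trmx_mul trmxK gx tr_scalar_mx.
  rewrite -scalar_mxM scale_scalar_mx /qf.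
  have F (A B : 'M[R]_1) : (A - B) 0 0 = A 0 0 - B 0 0 by rewrite !mxE.
  by rewrite F [_%:M _ _]mxE eqxx mulr1n expr2.
have an0 : a != 0 by rewrite gt_eqF.
by have -> : qf G x + 2 * - (s / a) * s + (- (s / a)) ^+ 2 * a = qf G x - a^-1 * s ^+ 2 by field.
Qed.

Lemma psd_diag_ge0 d (G : 'M[R]_d) i : psd G -> 0 <= G i i.
Proof. by move=> [_ /(_ (delta_mx i 0))]; rewrite qf_delta. Qed.

(** Induction on the number of nonzero diagonal entries: deflating at [i] clears entry (i, i), and a
    zero diagonal entry stays zero because its whole row vanishes by [psd_row0]. With a zero
    diagonal nothing is left. *)
Lemma psd_sum_rank1 d (G : 'M[R]_d) : psd G ->
  exists s : seq 'cV[R]_d, G = \sum_(c <- s) c *m c^T.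
Proof.
have [n] := ubnP #|[pred i | G i i != 0]|; elim: n G => // n IH G ltn pG.
case: (pickP [pred i | G i i != 0]) => [i /= nz|none].
  have a0 : 0 < G i i by rewrite lt_def nz psd_diag_ge0.
  set H := G - (G i i)^-1 *: (col i G *m (col i G)^T).
  have HE k : H k k = G k k - (G i i)^-1 * (G k i * G k i).
    by rewrite !mxE big_ord1 !mxE.
  have [||s sE] := IH H; last 2 first.
  - exact: psd_deflate.
  - exists ((Num.sqrt (G i i)^-1 *: col i G) :: s); rewrite big_cons -sE.
    rewrite linearZ /= -scalemxAl -scalemxAr scalerA -expr2 sqr_sqrtr ?invr_ge0 1?ltW//.
    by rewrite addrC subrK.
  rewrite ltnS in ltn; apply: leq_trans ltn; apply: proper_card; apply/properP; split.
    apply/fintype.subsetP => k; rewrite !inE HE; apply: contraNneq => Gk.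
    by rewrite (psd_row0 i pG Gk) Gk !mul0r mulr0 subr0.
  exists i; rewrite !inE // HE mulKf ?subrr ?eqxx//.
exists [::]; rewrite big_nil; apply/matrixP => i j; rewrite mxE psd_row0//.
by move: (none i) => /= /negbT; rewrite negbK => /eqP.
Qed.

End PSD.

(** * Powers-of-forms decompositions *)

Section Decompositions.
Variable R : realType.

(** On a vector x killed by T the common quadratic form vanishes, so the sum of the mu_j (T' x)_j^2
    is zero and positivity forces T' x = 0. The columns of [cokermx T] serve as the x. *)
Lemma diag_congr_sub m m' N (T : 'M[R]_(m, N)) (T' : 'M[R]_(m', N)) lam mu :
  (forall j, 0 < mu j) ->
  T^T *m diag_mx (\row_i lam i) *m T = T'^T *m diag_mx (\row_j mu j) *m T' ->
  (T' <= T)%MS.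
Proof.
move=> mu0 e; rewrite submxE; set K := cokermx T.
have TK : T *m K = 0 by exact: mulmx_coker.
have e0 : (T' *m K)^T *m diag_mx (\row_j mu j) *m (T' *m K) = 0.
  have -> : (T' *m K)^T *m diag_mx (\row_j mu j) *m (T' *m K) =
    K^T *m (T'^T *m diag_mx (\row_j mu j) *m T') *m K by rewrite trmx_mul !mulmxA.
  by rewrite -e -!mulmxA TK !mulmx0.
apply/eqP/matrixP => j a; rewrite [RHS]mxE.
have {e0} : \sum_j mu j * (T' *m K) j a ^+ 2 = 0.
  transitivity (((T' *m K)^T *m diag_mx (\row_j mu j) *m (T' *m K)) a a).
    rewrite mul_mx_diag mxE; apply: eq_bigr => l _.
    by move: (T' *m K) => Y; rewrite !mxE; ring.
  by rewrite e0 mxE.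
move/eqP; rewrite psumr_eq0 => [|l _]; last by rewrite mulr_ge0 ?sqr_ge0 ?ltW.
move/allP/(_ j); rewrite mem_index_enum => /(_ isT) /=.
by rewrite mulf_eq0 gt_eqF //= sqrf_eq0 => /eqP.
Qed.

Lemma unit_row_neq0 m (A : 'M[R]_m) j : A \in unitmx -> exists i, A j i != 0.
Proof.
move=> uA; apply: contrapT => none.
have /matrixP/(_ j j) := mulmxV uA; rewrite !mxE eqxx big1 => [/eqP|i _].
  by rewrite eq_sym oner_eq0.
suff -> : A j i = 0 by rewrite mul0r.
by apply/eqP; apply: contra_notT none => ?; exists i.
Qed.

(** In matrix terms, the squares say A^T diag(mu) A = diag(lam), so A is invertible; the derivative
    of the cubes in Y_c inserts the diagonal matrix of column c of A in the middle. Together they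
    make every row of A a unit vector. *)
Lemma powers_unique m (A : 'M[R]_m) (lam mu : 'I_m -> R) :
  (forall i, lam i != 0) ->
  \sum_j mu j *: lin A j ^+ 2 = \sum_i lam i *: lin 1%:M i ^+ 2 ->
  \sum_j mu j *: lin A j ^+ 3 = \sum_i lam i *: lin 1%:M i ^+ 3 ->
  forall j, exists i, row j A = delta_mx 0 i /\ mu j = lam i.
Proof.
move=> lam0 e2 e3.
have E2 : A^T *m diag_mx (\row_j mu j) *m A = diag_mx (\row_i lam i).
  transitivity ((1%:M : 'M[R]_m)^T *m diag_mx (\row_i lam i) *m 1%:M).
    by apply: qform_inj; rewrite ?sym_congr// -!sum_sqr_lcomb.
  by rewrite trmx1 mul1mx mulmx1.
have ul : diag_mx (\row_i lam i) \in unitmx.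
  by rewrite unitmxE det_diag unitfE; apply/prodf_neq0 => i _; rewrite mxE.
have [uB uA] : A^T *m diag_mx (\row_j mu j) \in unitmx /\ A \in unitmx.
  by move: ul; rewrite -E2 unitmx_mul => /andP[].
have key c i j : A j c * A j i = A j i * (i == c)%:R.
  have : A^T *m diag_mx (\row_j (mu j * (3%:R * A j c))) *m A =
         (1%:M : 'M[R]_m)^T *m diag_mx (\row_i (lam i * (3%:R * (1%:M : 'M[R]_m) i c))) *m 1%:M.
    apply: qform_inj; rewrite ?sym_congr// -!sum_sqr_lcomb.
    have D (T : 'M[R]_m) l : (\sum_j l j *: lin T j ^+ 3)^`M(c) =
        \sum_j (l j * (3%:R * T j c)) *: lin T j ^+ 2.
      rewrite raddf_sum /=; apply: eq_bigr => k _.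
      by rewrite mderivZ mderiv_lin3 scalerA.
    by rewrite -[LHS]D e3 D.
  rewrite trmx1 mul1mx mulmx1.
  have dd (x y : 'I_m -> R) : diag_mx (\row_i (x i * y i)) =
      diag_mx (\row_i x i) *m diag_mx (\row_i y i).
    by rewrite mulmx_diag; congr diag_mx; apply/rowP => k; rewrite !mxE.
  (* Once diag(lam) is replaced by A^T diag(mu) A, the invertible factor A^T diag(mu) cancels; entry
     (j, i) of the rest is three times the claim. *)
  rewrite (dd mu) (dd lam) -E2 -!mulmxA !(mulmxA A^T) => /(can_inj (mulKmx uB))/matrixP/(_ j i).
  rewrite mul_diag_mx mul_mx_diag !mxE => e.
  by apply: (@mulfI _ 3%:R); rewrite ?pnatr_eq0 // mulrA e; ring.
have rowE j i : A j i != 0 -> row j A = delta_mx 0 i.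
  move=> nz; apply/rowP => c; rewrite !mxE eqxx /=.
  by apply: (mulIf nz); rewrite key mulrC eq_sym.
move=> j; have [i nz] := unit_row_neq0 j uA; exists i.
split; first exact: rowE.
have Aji : A j i = 1 by have /rowP/(_ i) := rowE _ _ nz; rewrite !mxE !eqxx.
(* Entry (i, i) adds up the mu of all rows of A equal to e_i; invertibility leaves row [j] alone. *)
move/matrixP: E2 => /(_ i i); rewrite mul_mx_diag mxE [RHS]mxE eqxx mulr1n [RHS]mxE => <-.
rewrite (bigD1 j) //= big1 => [|j' jj']; first by rewrite !mxE Aji; ring.
have -> : A j' i = 0; last by rewrite mulr0.
apply/eqP; apply: contraT => nz'.
have : row j' A = row j A by rewrite (rowE _ _ nz) (rowE _ _ nz').
rewrite 2!matrix.rowE => /(can_inj (mulmxK uA)) /rowP/(_ j).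
by rewrite !mxE !eqxx /= eq_sym (negbTE jj') => /eqP; rewrite eq_sym oner_eq0.
Qed.

End Decompositions.

(** * Decompositions as indexed families, and the span of their forms *)

Section Families.
Variables (R : realType) (n k : nat).
Notation V := (dhomog n.+1 R k).
Implicit Types (s t : seq (V * R)).

Definition famq s (i : 'I_(size s)) : V := (tnth (in_tuple s) i).1.
Definition famw s (i : 'I_(size s)) : R := (tnth (in_tuple s) i).2.

Lemma fam_sum s (d : nat) :
  \sum_(c <- s) c.2 *: (c.1 : {mpoly R[n.+1]}) ^+ d =
  \sum_i famw i *: (@famq s i : {mpoly R[n.+1]}) ^+ d.
Proof. by rewrite big_tnth. Qed.

Lemma fam_map s : [tuple famq i | i < size s] = [seq c.1 | c <- s] :> seq V.
Proof.
by rewrite -[X in _ = map _ X](map_tnth_enum (in_tuple s)) -map_comp.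
Qed.

Lemma famE s : s = [seq (famq i, famw i) | i <- enum 'I_(size s)].
Proof.
rewrite -[LHS](map_tnth_enum (in_tuple s)).
by apply: eq_map => i; rewrite /famq /famw -surjective_pairing.
Qed.

Lemma fam_in s (c : V * R) : c \in s -> exists i, c = (@famq s i, famw i).
Proof. by rewrite {1}(famE s) => /mapP[i _ ->]; exists i. Qed.

Lemma in_fam s i : (@famq s i, famw i) \in s.
Proof. by rewrite -surjective_pairing mem_tnth. Qed.

Lemma span_lcomb m (q : 'I_m -> V) p :
  p \in <<[tuple q i | i < m]>>%VS -> exists a : 'rV_m, p = \sum_i a 0 i *: q i.
Proof.
move=> /coord_span pE; exists (\row_i coord [tuple q i | i < m] i p).
rewrite {1}pE; apply: eq_bigr => i _; rewrite mxE; congr (_ *: _).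
by rewrite -tnth_nth tnth_mktuple.
Qed.

Lemma mem_span_lcomb m (q : 'I_m -> V) (a : 'rV_m) :
  \sum_i a 0 i *: q i \in <<[tuple q i | i < m]>>%VS.
Proof.
apply: memv_suml => i _; apply/memvZ/memv_span.
by apply/mapP; exists i => //; rewrite mem_enum.
Qed.

Lemma famq_basis m N (b : 'I_N -> V) (q : 'I_m -> V) (T : 'M[R]_(m, N)) :
  (forall i, q i = \sum_a T i a *: b a) ->
  forall i, (q i : {mpoly R[n.+1]}) = lcomb T (tnth (formtuple b)) i.
Proof. by move=> qE i; rewrite lcomb_val qE. Qed.

Variable f2 : dhomog n.+1 R (2 * k).

(** Removing the term [i] leaves a sum of squares once the nonnegative weights are absorbed as
    square roots. *)
Lemma sosupp_summand m (q : 'I_m -> V) (lam : 'I_m -> R) :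
  (forall i, 0 <= lam i) ->
  (f2 : {mpoly R[n.+1]}) = \sum_i lam i *: (q i : {mpoly R[n.+1]}) ^+ 2 ->
  forall i, 0 < lam i -> sosupp f2 (q i).
Proof.
move=> lam0 e i li; exists (lam i) => //.
exists [seq Num.sqrt (lam j) *: q j | j <- rem i (index_enum 'I_m)].
rewrite big_map; have ii : i \in index_enum 'I_m by rewrite mem_index_enum.
rewrite e (big_rem i ii) /= [LHS]addrC addKr.
apply: eq_bigr => j _; rewrite exprZn sqr_sqrtr //.
Qed.

Let U := linspan (sosupp f2).
Let N := \dim U.
Hypothesis dimU3 : \dim (linspan (triple_products U)) = 'C(N + 2, 3).

Let b i : V := (vbasis U)`_(i : 'I_N).

Lemma sosupp_sub p : sosupp f2 p -> p \in U.
Proof. exact: (linspan_smallest _).1. Qed.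

Lemma vbasis_lcomb p : p \in U -> exists a : 'rV_N, p = \sum_i a 0 i *: b i.
Proof.
move=> /coord_vbasis ->; exists (\row_i coord (vbasis U) i p).
by apply: eq_bigr => i _; rewrite mxE.
Qed.

Lemma vbasis_inj2 : (0 < N)%N ->
  forall h : {mpoly R[N]}, h \is 2.-homog -> h \mPo formtuple b = 0 -> h = 0.
Proof.
move=> N0; apply: comp_inj_lower => //.
exact: (triple_products_inj N0 dimU3 vbasis_lcomb).
Qed.

(** Used in both directions: elements of [sosupp f2] lie in the span of an independent
    decomposition, and the forms of an independent decomposition lie in the span of those of any
    other one with positive weights. *)
Lemma squares_span m m' (q : 'I_m -> V) (p : 'I_m' -> V) (lam : 'I_m -> R) (mu : 'I_m' -> R) :
  (0 < N)%N ->
  (forall i, q i \in U) -> (forall j, p j \in U) -> (forall j, 0 < mu j) ->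
  \sum_i lam i *: (q i : {mpoly R[n.+1]}) ^+ 2 =
  \sum_j mu j *: (p j : {mpoly R[n.+1]}) ^+ 2 ->
  forall j, p j \in <<[tuple q i | i < m]>>%VS.
Proof.
move=> N0 qU pU mu0 e j.
have coords l (r : 'I_l -> V) : (forall i, r i \in U) ->
    exists T : 'M[R]_(l, N), forall i, r i = \sum_a T i a *: b a.
  move=> rU; have [a aE] := choice (fun i => vbasis_lcomb (rU i)).
  exists (\matrix_(i, x) a i 0 x) => i; rewrite {1}(aE i).
  by apply: eq_bigr => x _; rewrite mxE.
have [T TE] := coords _ _ qU; have [T' TE'] := coords _ _ pU.
have [/submxP[A AE]] : (T' <= T)%MS.
  apply: (diag_congr_sub (lam := lam) mu0).
  apply: (qform_comp_inj (vbasis_inj2 N0)); rewrite ?sym_congr//.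
  rewrite -!sum_sqr_lcomb; move: e.
  under eq_bigr do rewrite (famq_basis TE).
  by under [RHS]eq_bigr do rewrite (famq_basis TE').
have -> : p j = \sum_i (row j A) 0 i *: q i.
  rewrite TE' AE; under eq_bigr do rewrite mxE scaler_suml.
  rewrite exchange_big; apply: eq_bigr => i _; rewrite mxE TE scaler_sumr.
  by apply: eq_bigr => a _; rewrite scalerA.
exact: mem_span_lcomb.
Qed.

Section Basis.
Variables (m : nat) (q : 'I_m -> V) (lam : 'I_m -> R).
Hypotheses (m0 : (0 < m)%N) (lam0 : forall i, 0 < lam i).
Hypothesis fq : free [tuple q i | i < m].
Hypothesis f2q : (f2 : {mpoly R[n.+1]}) = \sum_i lam i *: (q i : {mpoly R[n.+1]}) ^+ 2.

Let qU i : q i \in U.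
Proof. by apply/sosupp_sub/(sosupp_summand _ f2q) => // j; exact: ltW. Qed.

Let qsub : (<<[tuple q i | i < m]>> <= U)%VS.
Proof. by apply/span_subvP => p /mapP[i _ ->]. Qed.

Let N0 : (0 < N)%N.
Proof.
apply: leq_trans m0 _; move: fq; rewrite /free size_tuple => /eqP <-; exact: dimvS.
Qed.

Lemma span_decomp : <<[tuple q i | i < m]>>%VS = U.
Proof.
apply/eqP; rewrite eqEsubv qsub /=.
apply: (linspan_smallest _).2 => p [l l0 [s sE]].
(* Membership of [p] in [sosupp f2] is itself a weighted sum of squares equal to f2, with [p] as the
   term of index 0. *)
pose t := (p, l) :: [seq (r, 1) | r <- s].
have tw (j : 'I_(size t)) : 0 < famw j.
  have := mem_tnth j (in_tuple t); rewrite /famw.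
  by rewrite inE => /orP[/eqP ->//|/mapP[r _ ->]]; exact: ltr01.
have tE : (f2 : {mpoly R[n.+1]}) = \sum_j famw j *: (@famq t j : {mpoly R[n.+1]}) ^+ 2.
  rewrite -fam_sum big_cons big_map /=.
  rewrite (eq_bigr (fun r : V => (r : {mpoly R[n.+1]}) ^+ 2)) => [|r _].
    by rewrite -sE addrC subrK.
  by rewrite scale1r.
have tU j : @famq t j \in U.
  by apply/sosupp_sub/(sosupp_summand _ tE) => // i; exact: ltW.
have e : \sum_i lam i *: (q i : {mpoly R[n.+1]}) ^+ 2 =
  \sum_j famw j *: (@famq t j : {mpoly R[n.+1]}) ^+ 2 by rewrite -f2q tE.
exact: (squares_span N0 qU tU tw e ord0).
Qed.

Lemma dim_decomp : m = N.
Proof. by rewrite /N -span_decomp; move: fq; rewrite /free size_tuple => /eqP. Qed.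

Lemma decomp_lcomb p : p \in U -> exists a : 'rV_m, p = \sum_i a 0 i *: q i.
Proof. by rewrite -span_decomp => /span_lcomb. Qed.

Lemma decomp_inj3 h : h \is 3.-homog -> h \mPo formtuple q = 0 -> h = 0.
Proof.
by apply: (triple_products_inj m0 _ decomp_lcomb); rewrite dimU3 -dim_decomp.
Qed.

Lemma decomp_inj2 h : h \is 2.-homog -> h \mPo formtuple q = 0 -> h = 0.
Proof. exact: comp_inj_lower m0 decomp_inj3 h. Qed.

Variable f3 : dhomog n.+1 R (3 * k).
Hypothesis f3q : (f3 : {mpoly R[n.+1]}) = \sum_i lam i *: (q i : {mpoly R[n.+1]}) ^+ 3.

(** Pulled back along [q], the family [q] has the identity as coordinate matrix and [p] has [A],
    which is the situation of [powers_unique]. *)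
Lemma decomp_unique (p : 'I_m -> V) (mu : 'I_m -> R) :
  (forall j, p j \in U) ->
  (f2 : {mpoly R[n.+1]}) = \sum_j mu j *: (p j : {mpoly R[n.+1]}) ^+ 2 ->
  (f3 : {mpoly R[n.+1]}) = \sum_j mu j *: (p j : {mpoly R[n.+1]}) ^+ 3 ->
  forall j, exists i, p j = q i /\ mu j = lam i.
Proof.
move=> pU f2p f3p j; have [a aE] := choice (fun i => decomp_lcomb (pU i)).
pose A := \matrix_(i, x) a i 0 x.
have pE i : p i = \sum_x A i x *: q x.
  by rewrite {1}(aE i); apply: eq_bigr => x _; rewrite mxE.
have qE i : q i = \sum_x (1%:M : 'M[R]_m) i x *: q x.
  rewrite (bigD1 i) //= mxE eqxx scale1r big1 ?addr0 // => x xi.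
  by rewrite mxE eq_sym (negbTE xi) scale0r.
have pull d (h h' : {mpoly R[m]}) :
    (forall h, h \is d.-homog -> h \mPo formtuple q = 0 -> h = 0) ->
    h \is d.-homog -> h' \is d.-homog -> h \mPo formtuple q = h' \mPo formtuple q -> h = h'.
  move=> inj hh hh' e; apply/eqP; rewrite -subr_eq0; apply/eqP; apply: inj.
    by rewrite rpredB.
  by rewrite raddfB /= e subrr.
have hom d (w : 'I_m -> R) (T : 'M[R]_m) : \sum_i w i *: lin T i ^+ d \is d.-homog.
  apply: rpred_sum => i _; apply: rpredZ.
  by have := dhomogMn d (lin_homog T i); rewrite mul1n.
have comp d (w : 'I_m -> R) (T : 'M[R]_m) (r : 'I_m -> V) :
    (forall i, r i = \sum_x T i x *: q x) ->
    (\sum_i w i *: lin T i ^+ d) \mPo formtuple q =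
    \sum_i w i *: (r i : {mpoly R[n.+1]}) ^+ d.
  move=> rE; rewrite raddf_sum; apply: eq_bigr => i _ /=.
  by rewrite comp_mpolyZ rmorphXn /= lin_comp -(famq_basis rE).
have [|||i [Ai mi]] := @powers_unique _ _ A lam mu _ _ _ j.
- by move=> i; rewrite gt_eqF.
- by apply: (pull 2) => //; [exact: decomp_inj2|rewrite (comp _ _ _ _ pE) (comp _ _ _ _ qE) -f2p].
- by apply: (pull 3) => //; [exact: decomp_inj3|rewrite (comp _ _ _ _ pE) (comp _ _ _ _ qE) -f3p].
exists i; split=> //; rewrite pE [RHS]qE; apply: eq_bigr => x _.
by move/rowP: Ai => /(_ x); rewrite !mxE eqxx /= eq_sym => ->.
Qed.

End Basis.

End Families.

(** * The Gram spectrahedron and Algorithm P *)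

Section Gram.
Variables (R : realType) (n k : nat).
Notation V := (dhomog n.+1 R k).
Variable f2 : dhomog n.+1 R (2 * k).
Let U := linspan (sosupp f2).
Let N := \dim U.
Hypothesis dimU3 : \dim (linspan (triple_products U)) = 'C(N + 2, 3).
Variables (m : nat) (q : 'I_m -> V) (lam : 'I_m -> R).
Hypotheses (m0 : (0 < m)%N) (lam0 : forall i, 0 < lam i).
Hypothesis fq : free [tuple q i | i < m].
Hypothesis f2q : (f2 : {mpoly R[n.+1]}) = \sum_i lam i *: (q i : {mpoly R[n.+1]}) ^+ 2.

Definition monomials d (i : 'I_(nmon n.+1 d)) : {mpoly R[n.+1]} := 'X_[mon i].

Definition coefmx : 'M[R]_(nmon n.+1 k, m) := \matrix_(i, j) coefs (q j) i 0.

Lemma col_coefmx j : col j coefmx = coefs (q j).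
Proof. by apply/colP => i; rewrite !mxE. Qed.

Lemma lcomb_monomials d r (A : 'M[R]_(r, nmon n.+1 d)) j :
  lcomb A (@monomials d) j = vform_mpoly (col j A^T).
Proof. by apply: eq_bigr => i _; rewrite !mxE. Qed.

Lemma lcomb_coefmx : lcomb coefmx^T (@monomials k) = tnth (formtuple q).
Proof.
apply/funext => j; rewrite lcomb_monomials trmxK col_coefmx coefsK.
by rewrite tnth_mktuple.
Qed.

Lemma gram_qform d (G : 'M[R]_(nmon n.+1 d)) :
  ((monvec R n.+1 d)^T *m map_mx (@mpolyC n.+1 R) G *m monvec R n.+1 d) 0 0 =
  qform G (@monomials d).
Proof.
rewrite mxE; under eq_bigr do rewrite mxE mulr_suml.
rewrite exchange_big; apply: eq_bigr => i _; apply: eq_bigr => j _.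
by rewrite !mxE -mul_mpolyC mulrA [in LHS](mulrC 'X_[_]).
Qed.

(** The Gram matrix of the decomposition, the sum of the lam_i c_i c_i^T over the coefficient
    vectors c_i of the q_i. *)
Definition gram0 := coefmx *m diag_mx (\row_i lam i) *m coefmx^T.

Lemma gram0_sym : gram0^T = gram0.
Proof. by rewrite /gram0 !trmx_mul trmxK tr_diag_mx mulmxA. Qed.

Lemma gram0_qform : qform gram0 (@monomials k) = f2.
Proof.
rewrite /gram0 -{1}[coefmx]trmxK qform_congr lcomb_coefmx f2q.
have := sum_sqr_lcomb lam 1%:M (tnth (formtuple q)).
rewrite trmx1 mul1mx mulmx1 => <-; apply: eq_bigr => i _.
by rewrite lcomb1 tnth_mktuple.
Qed.

Lemma gram0_Gram : Gram f2 gram0.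
Proof.
split; last by rewrite gram_qform gram0_qform.
split; first exact: gram0_sym.
move=> x; set y := coefmx^T *m x.
have -> : x^T *m gram0 *m x = y^T *m diag_mx (\row_i lam i) *m y.
  by rewrite /y trmx_mul trmxK /gram0 !mulmxA.
rewrite mul_mx_diag mxE; apply: sumr_ge0 => i _; rewrite !mxE mulrAC -expr2.
by rewrite mulr_ge0 ?sqr_ge0 ?ltW.
Qed.

(* The columns of a rank-one decomposition of a Gram matrix represent forms in
   [U], and the products of two basis elements of [U] are independent. *)
Lemma Gram_unique G : Gram f2 G -> G = gram0.
Proof.
move=> [pG]; rewrite gram_qform => eG.
have [s sE] := psd_sum_rank1 pG.
pose C : 'M[R]_(size s, nmon n.+1 k) := \matrix_(j, i) tnth (in_tuple s) j i 0.
pose p (j : 'I_(size s)) : V := vform (tnth (in_tuple s) j).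
have CE j : col j C^T = tnth (in_tuple s) j by apply/colP => i; rewrite !mxE.
have GE : G = C^T *m 1%:M *m C.
  rewrite sE mulmx1; apply/matrixP => i i'; rewrite big_tnth summxE !mxE.
  by apply: eq_bigr => j _; rewrite !mxE big_ord1 !mxE.
have pE : (f2 : {mpoly R[n.+1]}) = \sum_j 1 *: (p j : {mpoly R[n.+1]}) ^+ 2.
  rewrite -eG GE -[1%:M]diag_const_mx.
  have -> : const_mx 1 = \row_(i < size s) (1 : R) by apply/rowP => i; rewrite !mxE.
  rewrite -sum_sqr_lcomb; apply: eq_bigr => j _.
  by rewrite lcomb_monomials CE.
have pU j : p j \in U.
  by apply/sosupp_sub/(sosupp_summand _ pE).
have [a aE] := choice (fun j => decomp_lcomb dimU3 m0 lam0 fq f2q (pU j)).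
pose A := \matrix_(j, i) a j 0 i.
have CA : C = A *m coefmx^T.
  apply/matrixP => j i; have := congr1 (fun p : V => (p : {mpoly R[n.+1]})@_(mon i)) (aE j).
  rewrite /= mcoeff_vform !mxE => ->.
  rewrite raddf_sum /= raddf_sum; apply: eq_bigr => l _ /=.
  by rewrite mcoeffZ !mxE.
have {GE} GE : G = coefmx *m (A^T *m A) *m coefmx^T.
  by rewrite GE mulmx1 CA trmx_mul trmxK !mulmxA.
rewrite GE /gram0; congr (_ *m _ *m _).
apply: (@qform_comp_inj _ _ _ (formtuple q)).
- exact: (decomp_inj2 dimU3 m0 lam0 fq f2q).
- by rewrite trmx_mul trmxK.
- exact: tr_diag_mx.
have trick S : qform S (tnth (formtuple q)) = qform (coefmx *m S *m coefmx^T) (@monomials k).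
  by rewrite -{1}[coefmx]trmxK qform_congr lcomb_coefmx.
by rewrite !trick -GE eG -gram0_qform.
Qed.

(** The affine hull of a single point is that point, so any radius works. This provides the correct
    answer of [GramSDP] that almost sure success demands. *)
Lemma relint_gram0 : relint (Gram f2) gram0.
Proof.
split; first exact: gram0_Gram.
exists 1; first exact: ltr01.
move=> y [s [sC s1 ->]] _.
rewrite (eq_big_seq (fun c => c.1 *: gram0)).
  by rewrite -scaler_suml s1 scale1r; exact: gram0_Gram.
by move=> c /sC /Gram_unique ->.
Qed.

Variable f3 : dhomog n.+1 R (3 * k).
Hypothesis f3q : (f3 : {mpoly R[n.+1]}) = \sum_i lam i *: (q i : {mpoly R[n.+1]}) ^+ 3.

(** A relation among the coefficient vectors is a linear form killed by substituting [q], and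
    injectivity descends from degree 2 to degree 1. *)
Lemma row_free_coefmx : row_free coefmx^T.
Proof.
rewrite -kermx_eq0; apply/eqP/row_matrixP => l; rewrite row0; set x := row l _.
have xT : x *m coefmx^T = 0 by rewrite -row_mul mulmx_ker row0.
have x0 : lin x 0 \mPo formtuple q = 0.
  by rewrite lin_comp -lcomb_coefmx -lcomb_mul xT /lcomb big1 // => i _; rewrite mxE scale0r.
have inj1 := comp_inj_lower m0 (decomp_inj2 dimU3 m0 lam0 fq f2q).
by apply/rowP => i; rewrite -mcoeff_lin (inj1 _ (lin_homog x 0) x0) mcoeff0 mxE.
Qed.

(** [Image] yields some basis [W] of the column space of [gram0], which is that of [coefmx]. Writing
    q = P w, the forms g_d found by the run must be the weighted power sums of the rows of [P], to
    which [decompose_linearP] applies. *)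
Lemma algorithmP_correct :
  almost_surely (algorithmP (coefs f2) (coefs f3))
    (fun out => perm_eq [seq (vform c.1, c.2) | c <- out]
                        [seq (q i, lam i) | i <- enum 'I_m]).
Proof.
rewrite /algorithmP; split.
  by exists (Some gram0); rewrite /= vform_coefs; exact: relint_gram0.
case=> [G|]; rewrite /correct vform_coefs; last first.
  by move=> G0; have := gram0_Gram; rewrite G0.
move=> [/Gram_unique -> _] {G}; reduce_prog.
apply: as_image => r W fW eW; reduce_prog.
have fQ := row_free_coefmx.
have uD : diag_mx (\row_i lam i) \in unitmx.
  by rewrite unitmxE det_diag unitfE; apply/prodf_neq0 => i _; rewrite mxE gt_eqF.
have eQ : (W^T == coefmx^T)%MS.
  apply/eqmxP; apply: eqmx_trans (eqmxP eW) _; rewrite gram0_sym; apply: eqmxMfull.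
  by rewrite /row_full -mxrank_tr trmx_mul tr_diag_mx mxrankMfree // mxrank_unit.
have rm : r = m by rewrite -(eqP fW) -[RHS](eqP fQ); move/eqmxP: eQ => ->.
subst r.
have /submxP[P QP] : (coefmx^T <= W^T)%MS by case/andP: eQ.
have uP : P \in unitmx.
  rewrite -row_free_unit /row_free eqn_leq rank_leq_row /=.
  by rewrite -{1}(eqP fQ) QP mxrankM_maxl.
have WQ j : tnth (forms W) j = lcomb (invmx P) (tnth (formtuple q)) j.
  rewrite -lcomb_coefmx -lcomb_mul QP mulmxA mulVmx // mul1mx lcomb_monomials trmxK.
  by rewrite tnth_mktuple.
have qW i : lcomb P (tnth (forms W)) i = q i.
  rewrite (_ : lcomb _ _ _ = lcomb P (lcomb (invmx P) (tnth (formtuple q))) i).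
    by rewrite -lcomb_mul mulmxV // lcomb1 tnth_mktuple.
  by apply: eq_bigr => j _; rewrite WQ.
have fV : row_free (invmx P) by rewrite row_free_unit unitmx_inv.
have inj3 := comp_inj_unit fV WQ (decomp_inj3 dimU3 m0 lam0 fq f2q).
have inj2 := comp_inj_lower m0 inj3.
have hom d : \sum_i lam i *: lin P i ^+ d \is d.-homog.
  apply: rpred_sum => i _; apply: rpredZ.
  by have := dhomogMn d (lin_homog P i); rewrite mul1n.
have comp d : (\sum_i lam i *: lin P i ^+ d) \mPo forms W =
    \sum_i lam i *: (q i : {mpoly R[n.+1]}) ^+ d.
  rewrite raddf_sum; apply: eq_bigr => i _ /=.
  by rewrite comp_mpolyZ rmorphXn /= lin_comp qW.
apply: as_bind.
  apply: (expressP (hom 2%N) _ inj2).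
  by rewrite comp coefsK f2q.
move=> g2 g2E; apply: as_bind.
  apply: (expressP (hom 3%N) _ inj3).
  by rewrite comp coefsK f3q.
move=> g3 g3E; apply: as_bind.
  apply: (decompose_linearP _ _ g2E g3E) => [|i]; last by rewrite gt_eqF.
  by rewrite row_free_unit.
move=> [m' [L l]] [s [bs sP]]; reduce_prog.
apply: as_mul; reduce_prog.
set Q := _ *m L.
have QE j : vform (col j Q) = q (s j).
  apply: val_inj; rewrite /= -qW.
  have -> : Q = W *m ((var1mx R m)^T *m L).
    rewrite /Q mulmxA; congr (_ *m L); apply/matrixP => i b.
    rewrite !mxE (bigD1 (var1 b)) //= !mxE eqxx mulr1 big1 ?addr0 // => a ab.
    by rewrite !mxE eq_sym (negbTE ab) mulr0.
  have -> : col j (W *m ((var1mx R m)^T *m L)) = W *m col j ((var1mx R m)^T *m L).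
    by rewrite !colE !mulmxA.
  rewrite vform_mulmx; apply: eq_bigr => a _.
  rewrite tnth_mktuple; congr (_ *: _).
  rewrite -(mcoeff_lin P) -(sP j).1 vform1 mcoeff_lin !mxE.
  by apply: eq_bigr => b _; rewrite !mxE mulrC.
rewrite /almost_surely.
have -> : [seq (vform c.1, c.2) | c <- [seq (col j Q, l j 0) | j <- enum 'I_m']] =
    [seq (q i, lam i) | i <- [seq s j | j <- enum 'I_m']].
  rewrite -!map_comp; apply: eq_map => j /=; congr (_, _); first exact: QE.
  exact: (sP j).2.
apply/perm_map/uniq_perm; rewrite ?enum_uniq //.
  by rewrite map_inj_uniq ?enum_uniq //; exact: bij_inj.
move=> i; rewrite mem_enum inE; apply/mapP.
have [t st ts] := bs; exists (t i); rewrite ?mem_enum// ts.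
Qed.

End Gram.

(** * Cost of Algorithm P *)

Section Cost.
Variable R : realType.

(** Refines [cost_le] by a property of the result: the cost of later calls depends on ranks returned
    earlier, so budgets compose only together with bounds on these ranks. *)
Fixpoint cost_post A (p : prog R A) (b : nat) (Q : A -> Prop) : Prop :=
  match p with
  | Ret a => Q a
  | Fail => True
  | Call o next => forall r, @correct R o r ->
      (op_size r < b)%N /\ cost_post (next r) (b - (op_size r).+1) Q
  end.

Lemma cost_post_le A (p : prog R A) b Q : cost_post p b Q -> cost_le p b.
Proof.
by elim: p b => //= o next IH b h r cr; have [? /IH] := h r cr.
Qed.

Lemma cost_post_mono A (p : prog R A) b b' (Q Q' : A -> Prop) :
  (b <= b')%N -> (forall a, Q a -> Q' a) -> cost_post p b Q -> cost_post p b' Q'.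
Proof.
move=> + QQ'; elim: p b b' => //= [a b b' _ /QQ'//|o next IH b b' bb' h r cr].
have [lt cn] := h r cr; split; first exact: leq_trans lt bb'.
exact: IH (leq_sub2r _ bb') cn.
Qed.

Lemma cost_post_bind A B (p : prog R A) (f : A -> prog R B) b b' Q Q' :
  cost_post p b Q -> (forall a, Q a -> cost_post (f a) b' Q') ->
  cost_post (bind p f) (b + b') Q'.
Proof.
move=> + Qf; elim: p b => //= [a b /Qf|o next IH b h r cr].
  by apply: cost_post_mono => //; exact: leq_addl.
have [lt cn] := h r cr; split; first exact: leq_trans lt (leq_addr _ _).
by rewrite -addnBAC //; exact: IH.
Qed.

Lemma nmon_le_exp N d : (nmon N d <= N ^ d)%N.
Proof. by rewrite -[N in leqRHS]card_ord -card_tuple max_card. Qed.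

Lemma nmon_mono n d e : (d <= e)%N -> (nmon n.+1 d <= nmon n.+1 e)%N.
Proof.
have sym c : nmon n.+1 c = 'C(c + n, n) by rewrite nmonS -bin_sub ?leq_addr// addKn.
by move=> de; rewrite !sym leq_bin2l // leq_add2r.
Qed.

Variable S : nat.
Hypothesis S0 : (0 < S)%N.
(** The forms in X have at most [S] coefficients, so U has at most [S] basis vectors, and forms of
    degree at most 3 in that many variables have at most S^3 coefficients. Thus [D] bounds every
    matrix dimension. *)
Let D := (S ^ 3)%N.
(* [GenEig] is the largest call, with 3m^2 + m <= 4D^2 entries. *)
Let K := (5 * (D * D))%N.

Let D0 : (0 < D)%N. Proof. by rewrite expn_gt0 S0. Qed.

Let SD : (S <= D)%N. Proof. by rewrite -{1}(expn1 S) leq_pexp2l. Qed.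

Let nmonD N d : (N <= S)%N -> (d <= 3)%N -> (nmon N d <= D)%N.
Proof.
move=> NS d3; apply: leq_trans (nmon_le_exp N d) _.
apply: leq_trans (leq_pexp2l S0 d3).
by elim: d {d3} => // d IH; rewrite !expnS leq_mul.
Qed.

Let dims p q : (p <= D)%N -> (q <= D)%N -> (p * q <= D * D)%N.
Proof. exact: leq_mul. Qed.

Let dim1 p : (p <= D)%N -> (p <= D * D)%N.
Proof. by move=> pD; rewrite -[p]muln1; apply: leq_mul. Qed.

Definition any A (_ : A) := True.

Lemma cost_const p q (C : 'M[rat]_(p, q)) : (p <= D)%N -> (q <= D)%N ->
  cost_post (call (@Const R _ _ C)) K (@any _).
Proof.
move=> pD qD r _ /=; split=> //; have := dims pD qD; have := muln_gt0 D D; rewrite D0 /K; lia.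
Qed.

Lemma cost_mul p q r (A : 'M[R]_(p, q)) (B : 'M[R]_(q, r)) :
  (p <= D)%N -> (q <= D)%N -> (r <= D)%N -> cost_post (call (Mul A B)) K (@any _).
Proof.
move=> pD qD rD x _ /=; split=> //.
have := dims pD qD; have := dims pD rD; have := dims qD rD.
have := muln_gt0 D D; rewrite D0 /K; lia.
Qed.

Lemma cost_solve p q (A : 'M[R]_(p, q)) b :
  (p <= D)%N -> (q <= D)%N -> cost_post (call (Solve A b)) K (@any _).
Proof.
move=> pD qD x _ /=; split=> //.
have := dims pD qD; have := dim1 pD; have := dim1 qD; have := muln_gt0 D D; rewrite D0 /K; lia.
Qed.

(** The only call whose answer has a size not fixed in advance; correctness bounds the rank by the
    number of columns. *)
Lemma cost_image p q (A : 'M[R]_(p, q)) : (p <= D)%N -> (q <= D)%N ->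
  cost_post (call (Image A)) K (fun im => (projT1 im <= q)%N).
Proof.
move=> pD qD [r W] /= /andP[/eqP fW /andP[sW _]].
have rq : (r <= q)%N.
  by rewrite -fW; apply: leq_trans (mxrankS sW) _; exact: rank_leq_row.
split=> //; have rD := leq_trans rq qD.
have := dims pD qD; have := dims pD rD; have := muln_gt0 D D; rewrite D0 /K; lia.
Qed.

Lemma cost_eig m (A B : 'M[R]_m) : (m <= D)%N -> cost_post (call (GenEig A B)) K (@any _).
Proof.
move=> mD x _ /=; split=> //.
have := dims mD mD; have := dim1 mD; have := muln_gt0 D D; rewrite D0 /K; lia.
Qed.

Lemma cost_random N : (N <= D)%N -> cost_post (call (@Random R N)) K (@any _).
Proof.
by move=> ND x _ /=; split=> //; have := dim1 ND; have := muln_gt0 D D; rewrite D0 /K; lia.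
Qed.

Lemma cost_gram n k (f : 'cV[R]_(nmon n (2 * k))) : (nmon n (2 * k) <= D)%N -> (nmon n k <= D)%N ->
  cost_post (call (GramSDP f)) K (@any _).
Proof.
move=> fD kD x _ /=; split=> //.
have := dims kD kD; have := dim1 fD; have := muln_gt0 D D; rewrite D0 /K; lia.
Qed.

(* The conclusions unfold to implications, so the hypotheses would otherwise
   become implicit. *)
Arguments cost_const {p q} C _ _.
Arguments cost_mul {p q r} A B _ _ _.
Arguments cost_solve {p q} A b _ _.
Arguments cost_image {p q} A _ _.
Arguments cost_eig {m} A B _.
Arguments cost_random {N} _.
Arguments cost_gram {n k} f _ _.

Lemma cost_succeed A (x : option A) b : cost_post (succeed x : prog R A) b (@any _).
Proof. by case: x. Qed.

Lemma cost_columns p m (f : 'I_m -> prog R 'cV[R]_p) c :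
  (forall j, cost_post (f j) c (@any _)) -> cost_post (columns f) (m * c) (@any _).
Proof.
elim: m f => [//|m IH] f h /=.
rewrite mulSn; apply: cost_post_bind (h ord0) _ => x _.
by rewrite -[X in cost_post _ X]addn0; apply: cost_post_bind (IH _ _) _.
Qed.

(** Costs are counted in multiples of a unit [L], either [K] or [B], so that the budget of a
    sequence of calls is a sum of small numerals. *)
Lemma cost_step A B (p : prog R A) (f : A -> prog R B) a c (L : nat) Q Q' :
  cost_post p (a * L) Q -> (forall x, Q x -> cost_post (f x) ((c - a) * L) Q') ->
  (a <= c)%N -> cost_post (bind p f) (c * L) Q'.
Proof. by move=> hp hf ac; rewrite -(subnKC ac) mulnDl; exact: cost_post_bind hp hf. Qed.

Let one A (p : prog R A) Q : cost_post p K Q -> cost_post p (1 * K) Q.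
Proof. by rewrite mul1n. Qed.

Lemma cost_form_mul n a b (p : 'cV[R]_(nmon n a)) (q : 'cV[R]_(nmon n b)) :
  (nmon n b <= D)%N -> (nmon n (a + b) <= D)%N ->
  cost_post (form_mul p q) (2 * K) (@any _).
Proof.
move=> bD abD; apply: (cost_step (a := 1) (one (cost_const _ _ _)) _) => // z _.
by apply: (one (cost_mul _ _ _ _ _)).
Qed.

Arguments cost_form_mul {n a b} p q _ _.

(** One call for the empty product and two for each factor. *)
Lemma cost_form_prod n k N (U : 'M[R]_(nmon n k, N)) d (t : d.-tuple 'I_N) :
  (forall j, (j <= d)%N -> (nmon n (j * k) <= D)%N) ->
  cost_post (form_prod U t) ((2 * d).+1 * K) (@any _).
Proof.
elim: d t => [|d IH] t hD /=; first by apply: (one (cost_const _ _ _)) => //; exact: (hD 0%N).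
apply: (cost_step (a := (2 * d).+1)).
- by apply: IH => j jd; apply: hD; exact: leqW.
- move=> p _; apply: cost_post_mono (cost_form_mul _ _ _ _) => //.
  + by rewrite leq_mul2r; apply/orP; right; lia.
  + exact: (hD d (leqnSn d)).
  + exact: (hD d.+1 (leqnn _)).
- lia.
Qed.

(** The unit for loops: at most [D] columns, each computed by a few calls of cost [K]. *)
Let B := (D * K)%N.

Let KB c : (c * K <= c * B)%N.
Proof. by rewrite leq_mul2l leq_pmull ?orbT. Qed.

Let oneB A (p : prog R A) Q : cost_post p K Q -> cost_post p (1 * B) Q.
Proof. by move=> h; apply: cost_post_mono h => //; rewrite mul1n leq_pmull. Qed.

Lemma cost_columnsB p m (f : 'I_m -> prog R 'cV[R]_p) c : (m <= D)%N ->
  (forall j, cost_post (f j) (c * K) (@any _)) -> cost_post (columns f) (c * B) (@any _).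
Proof.
move=> mD h; apply: cost_post_mono (cost_columns h) => //.
by rewrite /B [leqLHS]mulnCA leq_mul2l leq_mul2r mD !orbT.
Qed.

(** The products of at most three forms take 2 * 3 + 1 = 7 units, the linear system one more. *)
Lemma cost_express n k N (U : 'M[R]_(nmon n k, N)) d (f : 'cV[R]_(nmon n (d * k))) :
  (N <= S)%N -> (d <= 3)%N ->
  (forall j, (j <= d)%N -> (nmon n (j * k) <= D)%N) ->
  cost_post (express U f) (8 * B) (@any _).
Proof.
move=> NS d3 hD; have ND := nmonD NS d3; apply: (cost_step (a := 7)) => //.
  apply: cost_columnsB => // i; apply: cost_post_mono (cost_form_prod _ _ hD) => //.
  by rewrite leq_mul2r; apply/orP; right; lia.
move=> A _; apply: (cost_step (a := 1)) => //.
  by apply: (oneB (cost_solve _ _ _ _)) => //; exact: hD.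
by move=> c _; exact: cost_succeed.
Qed.

Lemma cost_partials N d (g : 'cV[R]_(nmon N d.+1)) : (N <= S)%N -> (d < 3)%N ->
  cost_post (partials g) (2 * B) (@any _).
Proof.
move=> NS d3; apply: cost_columnsB => [|j]; first exact: leq_trans NS SD.
have d1 := nmonD NS d3; have d0 := nmonD NS (ltnW d3).
apply: (cost_step (a := 1) (one (cost_const _ _ _)) _) => // C _.
by apply: (one (cost_mul _ _ _ _ _)).
Qed.

Lemma cost_sym_matrix m (c : 'cV[R]_(nmon m 2)) : (m <= S)%N ->
  cost_post (sym_matrix c) (3 * B) (@any _).
Proof.
move=> mS; have m2 : (nmon m 2 <= D)%N by exact: nmonD.
apply: (cost_step (a := 1) (oneB (cost_const _ _ _)) _) => // x _.
apply: (cost_step (a := 1) (oneB (cost_mul _ _ _ _ _)) _) => // h _.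
apply: (cost_step (a := 1)) => //; first by apply: (oneB (cost_const _ _ _)).
Qed.

Arguments cost_sym_matrix {m} c _.

Lemma cost_decompose_linear N (g2 : 'cV[R]_(nmon N 2)) (g3 : 'cV[R]_(nmon N 3)) :
  (N <= S)%N ->
  cost_post (decompose_linear g2 g3) (41 * B) (fun r => (projT1 r <= S)%N).
Proof.
move=> NS; have ND := leq_trans NS SD.
have N1 : (nmon N 1 <= D)%N by exact: nmonD.
have N2 : (nmon N 2 <= D)%N by exact: nmonD.
have N3 : (nmon N 3 <= D)%N by exact: nmonD.
have hD d : (d <= 3)%N -> forall j, (j <= d)%N -> (nmon N (j * 1) <= D)%N.
  by move=> d3 j jd; rewrite muln1; apply: nmonD => //; exact: leq_trans jd d3.
rewrite /decompose_linear.
apply: (cost_step (a := 2) (cost_partials _ _ _) _) => // J2 _.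
apply: (cost_step (a := 1) (oneB (cost_image _ _ _)) _) => // -[m W] mN; reduce_prog.
have {}mN : (m <= N)%N := mN.
have mS := leq_trans mN NS; have mD := leq_trans mS SD.
apply: (cost_step (a := 1) (oneB (cost_random _)) _) => // v _.
apply: (cost_step (a := 8) (cost_express _ _ _ _ _) _) => //; first exact: hD.
move=> c2 _; apply: (cost_step (a := 3) (cost_sym_matrix _ _) _) => // M _.
apply: (cost_step (a := 2) (cost_partials _ _ _) _) => // J3 _.
apply: (cost_step (a := 1) (oneB (cost_mul _ _ _ _ _)) _) => // h _.
apply: (cost_step (a := 1) (oneB (cost_const _ _ _)) _) => // third _.
apply: (cost_step (a := 1) (oneB (cost_mul _ _ _ _ _)) _) => // h3 _.
apply: (cost_step (a := 8) (cost_express _ _ _ _ _) _) => //; first exact: hD.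
move=> c3 _; apply: (cost_step (a := 3) (cost_sym_matrix _ _) _) => // Mv _.
apply: (cost_step (a := 1) (oneB (cost_eig _ _ _)) _) => // eig _.
apply: (cost_step (a := 0) (cost_succeed _ _) _) => // muX _.
apply: (cost_step (a := 1) (oneB (cost_mul _ _ _ _ _)) _) => // Bm _.
apply: (cost_step (a := 1) (oneB (cost_mul _ _ _ _ _)) _) => // wv _.
apply: (cost_step (a := 1) (oneB (cost_mul _ _ _ _ _)) _) => // bwv _.
apply: (cost_step (a := 2) (cost_columnsB mD _) _) => // [j|A _].
  apply: (cost_step (a := 1) (one (cost_solve _ _ _ _)) _) => // y _.
  apply: (cost_step (a := 0) (cost_succeed _ _) _) => // c _.
  by apply: (one (cost_mul _ _ _ _ _)).
apply: (cost_step (a := 1) (oneB (cost_mul _ _ _ _ _)) _) => // L _.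
apply: (cost_step (a := 2) (cost_columnsB mD _) _) => // [j|SS _].
  exact: cost_form_mul.
apply: (cost_step (a := 1) (oneB (cost_solve _ _ _ _)) _) => // y _.
by apply: (cost_step (a := 0) (cost_succeed _ _) _) => // lambda _.
Qed.

Lemma cost_algorithmP n k (f2 : 'cV[R]_(nmon n (2 * k))) (f3 : 'cV[R]_(nmon n (3 * k))) :
  (forall j, (j <= 3)%N -> (nmon n (j * k) <= S)%N) ->
  cost_post (algorithmP f2 f3) (60 * B) (@any _).
Proof.
move=> hS; have kS : (nmon n k <= S)%N by have := hS 1%N isT; rewrite mul1n.
have hD d : (d <= 3)%N -> forall j, (j <= d)%N -> (nmon n (j * k) <= D)%N.
  by move=> d3 j jd; apply: leq_trans SD; apply: hS; exact: leq_trans jd d3.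
have kD := leq_trans kS SD.
apply: (cost_step (a := 1) (oneB (cost_gram _ _ _)) _) => //; first exact: (hD 2%N).
move=> oG _; apply: (cost_step (a := 0) (cost_succeed _ _) _) => // G _.
apply: (cost_step (a := 1) (oneB (cost_image _ _ _)) _) => // -[N U] NS; reduce_prog.
have {}NS : (N <= S)%N := leq_trans NS kS.
have ND := leq_trans NS SD.
apply: (cost_step (a := 8) (cost_express _ _ _ _ _) _) => //; first exact: hD.
move=> g2 _; apply: (cost_step (a := 8) (cost_express _ _ _ _ _) _) => //; first exact: hD.
move=> g3 _; apply: (cost_step (a := 41) (cost_decompose_linear _ _ _) _) => //.
move=> [m [L l]] mS; reduce_prog; have {}mS : (m <= S)%N := mS.
have mD := leq_trans mS SD.
apply: (cost_step (a := 1) (oneB (cost_mul _ _ _ _ _)) _) => //.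
exact: nmonD.
Qed.

End Cost.

Lemma algorithmP_polynomial (R : realType) n k (f2 : 'cV[R]_(nmon n.+1 (2 * k))) f3 :
  cost_le (algorithmP f2 f3) (300 * (nmon n.+1 (2 * k) + nmon n.+1 (3 * k)) ^ 9).
Proof.
set S := (_ + _)%N.
have S0 : (0 < S)%N by rewrite addn_gt0 nmonS bin_gt0 leq_addr.
have := @cost_algorithmP R S S0 n.+1 k f2 f3; set c := (60 * _)%N => h.
(* 60 B = 60 D (5 D^2) = 300 D^3 with D = S^3. The 60 units are 41 for [decompose_linear], 8 for
   each of the two uses of [express], and 3 for the remaining calls. *)
have -> : (300 * S ^ 9 = c)%N by rewrite /c !expnS expn0; nia.
apply: cost_post_le; apply: h => j j3; apply: leq_trans (leq_addl _ _).
by apply: nmon_mono; rewrite leq_mul2r j3 orbT.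
Qed.

(** * Uniqueness and minimality *)

Section Uniqueness.
Variables (R : realType) (n k : nat).
Notation V := (dhomog n.+1 R k).
Implicit Types (s t : seq (V * R)).
Variables (f2 : dhomog n.+1 R (2 * k)) (f3 : dhomog n.+1 R (3 * k)).
Let U := linspan (sosupp f2).
Hypothesis dimU3 : \dim (linspan (triple_products U)) = 'C(\dim U + 2, 3).

Lemma indep_fam s : indep_pof_decomp f2 f3 s ->
  [/\ forall i, 0 < @famw _ _ _ s i, free [tuple @famq _ _ _ s i | i < size s],
      (f2 : {mpoly R[n.+1]}) = \sum_i famw i *: (@famq _ _ _ s i : {mpoly R[n.+1]}) ^+ 2 &
      (f3 : {mpoly R[n.+1]}) = \sum_i famw i *: (@famq _ _ _ s i : {mpoly R[n.+1]}) ^+ 3].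
Proof.
move=> [_ s0 fs [e2 e3]]; split; rewrite -?fam_sum//.
- by move=> i; have := s0 _ (in_fam i).
- by rewrite fam_map.
Qed.

Lemma pof_summand s : pof_decomp f2 f3 s -> forall c, c \in s -> 0 < c.2 -> c.1 \in U.
Proof.
move=> [s0 [e2 _]] c /fam_in[i ->] /= wi.
apply/sosupp_sub/(sosupp_summand _ (etrans e2 (fam_sum s 2)) wi) => j.
exact: s0 (in_fam j).
Qed.

Lemma indep_pof s : indep_pof_decomp f2 f3 s -> pof_decomp f2 f3 s.
Proof. by move=> [_ s0 _ e]; split=> // c /s0 /ltW. Qed.

Lemma indep_size s : indep_pof_decomp f2 f3 s -> size s = \dim U.
Proof.
move=> hs; have [w0 fq e2 _] := indep_fam hs.
by case: hs => sz _ _ _; exact: (dim_decomp dimU3 sz w0 fq e2).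
Qed.

Lemma indep_uniq s : indep_pof_decomp f2 f3 s -> uniq s.
Proof. by case=> _ _ fs _; apply: map_uniq; exact: free_uniq fs. Qed.

Lemma indep_unique s t :
  indep_pof_decomp f2 f3 s -> indep_pof_decomp f2 f3 t -> perm_eq t s.
Proof.
move=> hs ht; have [w0 fq e2 e3] := indep_fam hs.
have sz : (0 < size s)%N by case: hs.
have st : size t = size s by rewrite !indep_size.
(* [t] is re-indexed by ['I_(size s)]; both sizes are dim U, so the default [x0] is never read. *)
pose x0 : V * R := (0, 0).
have big_t d : \sum_(c <- t) c.2 *: (c.1 : {mpoly R[n.+1]}) ^+ d =
    \sum_(j < size s) (nth x0 t j).2 *: ((nth x0 t j).1 : {mpoly R[n.+1]}) ^+ d.
  by rewrite (big_nth x0) big_mkord st.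
have sub : {subset t <= s}.
  move=> c ct; have jt : (index c t < size s)%N by rewrite -st index_mem.
  have [|||i [ci wi]] := decomp_unique dimU3 sz w0 fq e2 e3
      (p := fun j => (nth x0 t j).1) (mu := fun j => (nth x0 t j).2) _ _ _ (Ordinal jt).
  - move=> j; have [_ tw _ _] := ht.
    have jin : nth x0 t j \in t by rewrite mem_nth // st.
    exact: pof_summand (indep_pof ht) _ jin (tw _ jin).
  - by rewrite -big_t; case: ht => _ _ _ [].
  - by rewrite -big_t; case: ht => _ _ _ [].
  move: ci wi; rewrite /= nth_index // => ci wi.
  by rewrite [c]surjective_pairing ci wi in_fam.
have [_ eqi] := uniq_min_size (indep_uniq ht) sub (eq_leq (esym st)).
by apply: uniq_perm; rewrite ?indep_uniq.
Qed.

(** The forms of [s], a basis of U, lie in the span of those of [t]; this is the lower bound on the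
    rank. *)
Lemma pof_span s t : indep_pof_decomp f2 f3 s -> pof_decomp f2 f3 t ->
  (forall c, c \in t -> 0 < c.2) ->
  (\dim U <= \dim <<[seq c.1 | c <- t]>>)%N.
Proof.
move=> hs ht t0; have [w0 fq e2 _] := indep_fam hs.
have sz : (0 < size s)%N by case: hs.
have N0 : (0 < \dim U)%N by rewrite -(indep_size hs).
have sU i : @famq _ _ _ s i \in U by exact: (pof_summand (indep_pof hs) (in_fam i) (w0 i)).
have tU i : @famq _ _ _ t i \in U.
  by apply: (pof_summand ht (in_fam i)); exact: t0 (in_fam i).
have e : \sum_i famw i *: (@famq _ _ _ t i : {mpoly R[n.+1]}) ^+ 2 =
  \sum_i famw i *: (@famq _ _ _ s i : {mpoly R[n.+1]}) ^+ 2.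
  by rewrite -e2 -fam_sum; case: ht => _ [].
have sub := squares_span dimU3 N0 tU sU w0 e.
have := span_decomp dimU3 sz w0 fq e2; rewrite -/U -fam_map => <-; apply: dimvS.
by apply/span_subvP => _ /mapP[i _ ->]; exact: sub.
Qed.

(** Weights of a decomposition may be zero, and only the forms of positive weight are known to lie
    in U; dropping the others leaves the power sums unchanged. *)
Lemma pof_positive_part t : pof_decomp f2 f3 t ->
  pof_decomp f2 f3 [seq c <- t | 0 < c.2].
Proof.
move=> [t0 [e2 e3]]; split; first by move=> c; rewrite mem_filter => /andP[_ /t0].
have F d : \sum_(c <- t) c.2 *: (c.1 : {mpoly R[n.+1]}) ^+ d =
    \sum_(c <- [seq c <- t | 0 < c.2]) c.2 *: (c.1 : {mpoly R[n.+1]}) ^+ d.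
  rewrite big_filter [RHS]big_mkcond; apply: eq_big_seq => c /t0.
  by rewrite le_eqVlt => /orP[/eqP <-|->//]; rewrite ltxx scale0r.
by split; rewrite -F.
Qed.

Lemma indep_min_rank s : indep_pof_decomp f2 f3 s -> min_rank_pof_decomp f2 f3 s.
Proof.
move=> hs; split; first exact: indep_pof.
move=> t ht; rewrite (indep_size hs).
have pos c : c \in [seq c <- t | 0 < c.2] -> 0 < c.2.
  by rewrite mem_filter => /andP[].
apply: leq_trans (pof_span hs (pof_positive_part ht) pos) _.
by apply: leq_trans (dim_span _) _; rewrite size_map size_filter count_size.
Qed.

(** A minimum rank decomposition has dim U terms. Minimality excludes zero weights, and dim U forms
    spanning a space of at least that dimension are independent, so [indep_unique] applies. *)
Lemma min_rank_unique s t : indep_pof_decomp f2 f3 s ->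
  min_rank_pof_decomp f2 f3 t -> perm_eq t s.
Proof.
move=> hs [ht mint]; have [_ mins] := indep_min_rank hs.
have st : size t = \dim U.
  by rewrite -(indep_size hs); apply/eqP; rewrite eqn_leq mint ?mins//; exact: indep_pof.
apply: indep_unique => //.
have t0 c : c \in t -> 0 < c.2.
  have := mint _ (pof_positive_part ht); rewrite size_filter => szt.
  have : all (fun c : V * R => 0 < c.2) t by rewrite all_count eqn_leq count_size.
  by move/allP; exact.
split=> //.
- by rewrite st -(indep_size hs); case: hs.
- rewrite /free eqn_leq dim_span size_map st; exact: pof_span hs ht t0.
- by case: ht.
Qed.

End Uniqueness.

Theorem theorem1p1 (R : realType) :
  exists C e : nat,
  forall (n k : nat) (f2 : dhomog n.+1 R (2 * k)) (f3 : dhomog n.+1 R (3 * k)),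
  (0 < k)%N ->
  let U := linspan (sosupp f2) in
  let N := \dim U in
  \dim (linspan (triple_products U)) = 'C(N + 2, 3) ->
  (forall s t, indep_pof_decomp f2 f3 s -> indep_pof_decomp f2 f3 t ->
     perm_eq s t) /\
  (forall s, indep_pof_decomp f2 f3 s ->
     [/\ almost_surely (algorithmP (coefs f2) (coefs f3))
           (fun out => perm_eq [seq (vform c.1, c.2) | c <- out] s),
         cost_le (algorithmP (coefs f2) (coefs f3))
           (C * (nmon n.+1 (2 * k) + nmon n.+1 (3 * k)) ^ e),
         min_rank_pof_decomp f2 f3 s &
         forall t, min_rank_pof_decomp f2 f3 t -> perm_eq t s]).
Proof.
exists 300, 9 => n k f2 f3 _ U N dimU3; split=> [s t hs ht|s hs].
  exact: indep_unique dimU3 _ _ ht hs.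
split.
- have [w0 fq e2 e3] := indep_fam hs; have sz : (0 < size s)%N by case: hs.
  have := algorithmP_correct dimU3 sz w0 fq e2 e3; rewrite -famE; exact.
- exact: (@algorithmP_polynomial R n k).
- exact: indep_min_rank.
- by move=> t; exact: min_rank_unique.
Qed.
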